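(* Let $G$ be a finite simple graph with treewidth at most $6$. Then $\tau(G)\leq 2\,\nu(G)$.
   Context: A triangle transversal of a graph $G$ is a set of edges of $G$ whose removal leaves a triangle-free graph; a triangle packing of $G$ is a set of pairwise edge-disjoint triangles of $G$. $\tau(G)$ denotes the minimum size of a triangle transversal of $G$, and $\nu(G)$ the maximum size of a triangle packing of $G$. *)

(* Defs.v *)
From mathcomp Require Import all_boot.
Set Implicit Arguments. Unset Strict Implicit. Unset Printing Implicit Defensive.

Definition simple_graph (T : finType) (e : rel T) : Prop :=
  symmetric e /\ irreflexive e.

Section Triangles.
Variables (T : finType) (e : rel T).

Definition edges : {set {set T}} :=
  [set E : {set T} | [exists x, exists y, e x y && (E == [set x; y])]].

Definition triangles : {set {set T}} :=
  [set S : {set T} | [exists x, exists y, exists z,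
     [&& e x y, e y z, e x z & S == [set x; y; z]]]].

Definition tri_edges (S : {set T}) : {set {set T}} :=
  [set E in edges | E \subset S].

Definition triangle_transversal (F : {set {set T}}) : bool :=
  (F \subset edges) &&
  [forall S in triangles, [exists E in F, E \subset S]].

Definition triangle_packing (P : {set {set T}}) : bool :=
  (P \subset triangles) &&
  [forall S1 in P, forall S2 in P,
     (S1 != S2) ==> [disjoint tri_edges S1 & tri_edges S2]].

(* tau(G): minimum size of a triangle transversal (edges itself is one) *)
Definition tau : nat :=
  \big[minn/#|edges|]_(F : {set {set T}} | triangle_transversal F) #|F|.

(* nu(G): maximum size of a triangle packing (the empty set is one) *)
Definition nu : nat :=
  \max_(P : {set {set T}} | triangle_packing P) #|P|.

End Triangles.

Definition is_tree (I : finType) (r : rel I) : Prop :=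
  [/\ symmetric r, irreflexive r, 0 < #|I|,
      (forall i j, connect r i j) &
      (forall c : seq I, uniq c -> 2 < size c -> ~~ cycle r c)].

Definition tree_decomposition (T : finType) (e : rel T)
  (I : finType) (r : rel I) (B : I -> {set T}) : Prop :=
  [/\ is_tree r,
      (forall v : T, exists i, v \in B i),
      (forall x y, e x y -> exists i, (x \in B i) && (y \in B i)) &
      (forall v i j, v \in B i -> v \in B j ->
         connect [rel a b | [&& r a b, v \in B a & v \in B b]] i j)].

Definition treewidth_le (T : finType) (e : rel T) (k : nat) : Prop :=
  exists (n : nat) (r : rel 'I_n) (B : 'I_n -> {set T}),
    tree_decomposition e r B /\ forall i, #|B i| <= k.+1.

(* Main.v *)
Require Import Defs.
From mathcomp Require Import all_boot.
Set Implicit Arguments. Unset Strict Implicit. Unset Printing Implicit Defensive.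

(** In a counterexample with fewest edges one cannot find a set [D] of edges,
    a triangle packing [P] using only edges of [D], and a set [S] of at most
    [2 * #|P|] edges of [D] that hits every triangle meeting [D]: deleting [D]
    would give a smaller counterexample (Puleo's reducibility).  A vertex of
    degree at most 6 in an irreducible graph has a link that is [K_5] or [K_6]
    with few edges missing.  Eliminate the vertices along the tree
    decomposition, from the leaves to the root, and let [u] be the first vertex
    having an earlier neighbour.  The earlier neighbours of [u] (its children)
    have all their neighbours in a set [W] of at most 7 vertices containing [u],
    and [u] has no neighbours outside [W] and its children.  One child, or two
    children, yield a reduction, unless the links of the two children are
    copies of [K_5] sharing a triangle and spanning [W]; then either [u] and
    its two children, or three children, yield a reduction.

    Each of these statements concerns at most 10 labelled vertices.  It is
    proved by a table of explicit reductions, each valid as soon as certain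
    pairs are edges and certain pairs are not, together with a check that every
    graph satisfies the requirements of some entry of the table. *)

(** * Reducible graphs *)

Section Reductions.
Variable T : finType.
Implicit Types (e : rel T) (D F P : {set {set T}}).

Lemma edgesP e (E : {set T}) :
  reflect (exists x y, e x y /\ E = [set x; y]) (E \in edges e).
Proof.
rewrite inE; apply: (iffP existsP) =>
  [[x /existsP[y /andP[exy /eqP->]]]|[x [y [exy ->]]]].
  by exists x, y.
by exists x; apply/existsP; exists y; rewrite exy eqxx.
Qed.

Lemma trianglesP e (t : {set T}) :
  reflect (exists x y z, [/\ e x y, e y z, e x z & t = [set x; y; z]])
          (t \in triangles e).
Proof.
rewrite inE; apply: (iffP existsP).
  by case=> x /existsP[y /existsP[z /and4P[? ? ? /eqP->]]]; exists x, y, z.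
case=> x [y [z [exy eyz exz ->]]]; exists x; apply/existsP; exists y.
by apply/existsP; exists z; rewrite exy eyz exz eqxx.
Qed.

Lemma tri_edgesE e x y z (E : {set T}) : simple_graph e ->
  E \in tri_edges e [set x; y; z] ->
  [\/ E = [set x; y], E = [set y; z] | E = [set x; z]].
Proof.
case=> _ irr; rewrite inE => /andP[/edgesP[a [b [eab ->]]] sub].
have ab : a != b by apply: contraTneq eab => ->; rewrite irr.
move/subsetP: sub => sub.
have := sub a; have := sub b; rewrite !inE !eqxx orbT => /(_ isT) hb /(_ isT) ha.
case/orP: ha hb ab => [/orP[]|] /eqP-> => /orP[/orP[]|] /eqP->;
  rewrite ?eqxx // => _;
  by [constructor 1 | constructor 2 | constructor 3 | rewrite setUC; constructor 1
     | rewrite setUC; constructor 2 | rewrite setUC; constructor 3].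
Qed.

Lemma tau_le e F : triangle_transversal e F -> tau e <= #|F|.
Proof.
move=> trF; rewrite /tau; have := mem_index_enum F.
elim: (index_enum _) => // G s IHs; rewrite inE big_cons => /orP[/eqP<-|Fs].
  by rewrite trF geq_minl.
by case: ifP => _; rewrite ?geq_min IHs ?orbT.
Qed.

Lemma tau_witness e : exists2 F, triangle_transversal e F & #|F| = tau e.
Proof.
rewrite /tau; elim/big_rec: _ => [|F m trF [G trG <-]].
  exists (edges e) => //; rewrite /triangle_transversal subxx.
  apply/forallP=> t; apply/implyP=> /trianglesP[x [y [z [exy _ _ ->]]]].
  apply/existsP; exists [set x; y]; apply/andP; split; last exact: subsetUl.
  by apply/edgesP; exists x, y.
by rewrite minnC /minn; case: ltnP => _; [exists G | exists F].
Qed.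

Lemma nu_ge e P : triangle_packing e P -> #|P| <= nu e.
Proof. exact: leq_bigmax_cond. Qed.

Lemma nu_witness e : exists2 P, triangle_packing e P & #|P| = nu e.
Proof.
rewrite /nu; elim/big_rec: _ => [|F m trF [G trG <-]].
  exists set0; last exact: cards0.
  by rewrite /triangle_packing sub0set; apply/forallP=> t; rewrite inE.
by rewrite /maxn; case: ltnP => _; [exists G | exists F].
Qed.

Definition del_edges e D : rel T :=
  fun x y => e x y && ([set x; y] \notin D).

Lemma simple_del_edges e D : simple_graph e -> simple_graph (del_edges e D).
Proof.
by case=> sym irr; split=> [x y|x]; rewrite /del_edges ?irr // sym setUC.
Qed.

Lemma edges_del e D : edges (del_edges e D) = edges e :\: D.
Proof.
apply/setP=> E; rewrite in_setD; apply/edgesP/idP.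
  by case=> x [y [/andP[exy nD] ->]]; rewrite nD; apply/edgesP; exists x, y.
by case/andP=> nD /edgesP[x [y [exy def]]]; exists x, y;
  rewrite /del_edges exy -def.
Qed.

Lemma triangles_del e D t : simple_graph e ->
  (t \in triangles (del_edges e D)) = (t \in triangles e) && [disjoint
    tri_edges e t & D].
Proof.
move=> sg; apply/trianglesP/andP.
  case=> x [y [z [/andP[exy nxy] /andP[eyz nyz] /andP[exz nxz] ->]]]; split.
    by apply/trianglesP; exists x, y, z.
  by apply/pred0P=> E /=; apply/negP=> /andP[/(tri_edgesE sg)[] ->]; apply/negP.
case=> /trianglesP[x [y [z [exy eyz exz ->]]]] /disjointFr dis.
exists x, y, z; rewrite /del_edges exy eyz exz; split=> //; apply/negbT/dis;
  rewrite !inE;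
 apply/andP; split.
- by apply/existsP; exists x; apply/existsP; exists y; rewrite exy eqxx.
- exact: subsetUl.
- by apply/existsP; exists y; apply/existsP; exists z; rewrite eyz eqxx.
- by rewrite -setUA subsetUr.
- by apply/existsP; exists x; apply/existsP; exists z; rewrite exz eqxx.
by apply/subsetP=> w; rewrite !inE => /orP[] ->; rewrite ?orbT.
Qed.

Lemma tri_edges_del e D t : tri_edges (del_edges e D) t = tri_edges e t :\: D.
Proof.
by apply/setP=> E; rewrite /tri_edges edges_del in_setD in_set in_setD in_set andbA.
Qed.

Definition reducible e := exists D S P : {set {set T}},
  [/\ D != set0, D \subset edges e, S \subset D & triangle_packing e P] /\
  [/\ forall t, t \in P -> tri_edges e t \subset D,
      #|S| <= 2 * #|P|
    & forall t, t \in triangles e -> ~~ [disjoint tri_edges e t & D] ->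
        exists2 E, E \in S & E \subset t].

Lemma tri_edges_neq0 e t : t \in triangles e -> exists E, E \in tri_edges e t.
Proof.
case/trianglesP=> x [y [z [exy _ _ ->]]]; exists [set x; y];
  rewrite inE subsetUl andbT.
by apply/edgesP; exists x, y.
Qed.

(** A transversal of the graph without [D], enlarged by [S], is a transversal of [e]: triangles
    avoiding [D] survive the deletion, and the others are hit by [S]. A packing of the graph without
    [D] may be enlarged by [P], because its triangles have no edge in [D] while those of [P] have
    all their edges there. *)
Lemma reducible_step e (D S P : {set {set T}}) : simple_graph e ->
  S \subset D -> D \subset edges e -> triangle_packing e P ->
  (forall t, t \in P -> tri_edges e t \subset D) ->
  (forall t, t \in triangles e -> ~~ [disjoint tri_edges e t & D] ->
     exists2 E, E \in S & E \subset t) ->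
  tau e <= tau (del_edges e D) + #|S| /\ nu (del_edges e D) + #|P| <= nu e.
Proof.
move=> sg SD De packP PD hitS; split.
  have [F /andP[Fe /forallP hitF] <-] := tau_witness (del_edges e D).
  apply: leq_trans (leq_card_setU F S); apply: tau_le; apply/andP; split.
    rewrite subUset (subset_trans SD De) andbT.
    by apply: subset_trans Fe _; rewrite edges_del subsetDl.
  apply/forallP=> t; apply/implyP=> te.
  have [dis|] := boolP [disjoint tri_edges e t & D]; last first.
    case/(hitS _ te) => E ES Et; apply/existsP; exists E.
    by rewrite inE ES orbT.
  have := hitF t; rewrite triangles_del // te dis => /existsP[E /andP[EF Et]].
  by apply/existsP; exists E; rewrite inE EF.
have [Q /andP[Qe /forallP packQ] <-] := nu_witness (del_edges e D).
case/andP: packP => Pe /forallP packP.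
have dQ t : t \in Q -> [disjoint tri_edges e t & D].
  by move/(subsetP Qe); rewrite triangles_del // => /andP[].
have eQ t : t \in Q -> t \in triangles e.
  by move/(subsetP Qe); rewrite triangles_del // => /andP[].
have PQ t s : t \in P -> s \in Q -> [disjoint tri_edges e t & tri_edges e s].
  by move=> tP sQ; rewrite disjoint_sym; apply: disjointWr (PD t tP) (dQ s sQ).
(* The two packings have no common member: every triangle has an edge, and that edge would lie both
   inside and outside [D]. *)
have disQP : [disjoint Q & P].
  apply/pred0P=> t /=; apply/negP=> /andP[tQ tP].
  have [E Et] := tri_edges_neq0 (eQ t tQ).
  by have := PQ t t tP tQ => /pred0P/(_ E) /=; rewrite Et.
have /eqP<- : #|Q :|: P| == #|Q| + #|P| by rewrite (leq_card_setU Q P).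
apply: nu_ge; apply/andP; split.
  by rewrite subUset Pe andbT; apply/subsetP.
apply/forallP=> t; apply/implyP=> tU; apply/forallP=> s; apply/implyP=> sU.
apply/implyP=> ts; move: tU sU; rewrite !inE => /orP[tQ|tP] /orP[sQ|sP].
- have := packQ t; rewrite tQ => /forallP/(_ s); rewrite sQ ts !tri_edges_del.
  by rewrite !(setDidPl (dQ _ _)).
- by rewrite disjoint_sym; apply: PQ.
- exact: PQ.
by have := packP t; rewrite tP => /forallP/(_ s); rewrite sP ts.
Qed.

(** Strong induction on the number of edges, inside a class [Q] closed under edge deletion. The
    inequality is boolean, so reducibility up to double negation suffices; later arguments can
    therefore assume irreducibility and aim at [False]. *)
Lemma tuza_of_reducible (Q : rel T -> Prop) :
  (forall e D, Q e -> Q (del_edges e D)) ->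
  (forall e x y, simple_graph e -> Q e -> e x y -> ~ ~ reducible e) ->
  forall e, simple_graph e -> Q e -> tau e <= 2 * nu e.
Proof.
move=> Qdel Qred e; have [n] := ubnP #|edges e|; elim: n e => // n IHn e ltn sg Qe.
have [e0|[E0 /edgesP[x [y [exy _]]]]] := set_0Vmem (edges e).
  apply: (@leq_trans 0) => //; rewrite -(@cards0 {set T}); apply: tau_le.
  rewrite /triangle_transversal sub0set; apply/forallP=> t; apply/implyP.
  case/trianglesP=> x [y [z [exy _ _ _]]].
  by have: [set x; y] \in edges e by [apply/edgesP; exists x, y]; rewrite e0 inE.
apply/negPn/negP=> not_tuza.
apply: (Qred e x y sg Qe exy) => -[D [S [P [[D0 De SD packP] [PD leS hitS]]]]].
have [tauD nuD] := reducible_step sg SD De packP PD hitS.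
have IH: tau (del_edges e D) <= 2 * nu (del_edges e D).
  apply: IHn; [|exact: simple_del_edges|exact: Qdel].
  rewrite edges_del; move: ltn; rewrite ltnS; apply: leq_trans.
  apply: proper_card; apply/properP; split; first exact: subsetDl.
  by case/set0Pn: D0 => E ED; exists E; rewrite ?(subsetP De) // inE ED.
case/negP: not_tuza; apply: leq_trans tauD _.
by apply: leq_trans (leq_mul (leqnn 2) nuD); rewrite mulnDr leq_add.
Qed.

End Reductions.

(** * Reductions on labelled vertices *)

(** The increasing representative of an unordered pair, which is the form used throughout the
    tables. *)
Definition label_pair (i j : nat) := if i < j then (i, j) else (j, i).

Definition pairs_of (q : seq nat) : seq (nat * nat) :=
  [seq p <- allpairs pair q q | p.1 < p.2].

(* Pairs required to be edges, and pairs required not to be edges. *)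
Definition term := (seq (nat * nat) * seq (nat * nat))%type.

Definition sat (a : nat -> nat -> bool) (t : term) : bool :=
  all (fun p => a p.1 p.2) t.1 && all (fun p => ~~ a p.1 p.2) t.2.

(** * Checking that a list of terms covers all graphs *)

Section Tautology.

(* A term becomes a vector of requirements on the variables, in a fixed order;
   without trailing [None]s, it is satisfied exactly when it reaches [[::]]. *)
Fixpoint trim (s : seq (option bool)) : seq (option bool) :=
  if s is o :: s' then
    let r := trim s' in if (o, r) is (None, [::]) then [::] else o :: r
  else [::].

Definition step (b : bool) (s : seq (option bool)) :=
  match s with
  | [::] => Some [::]
  | None :: s' => Some s'
  | Some c :: s' => if c == b then Some s' else None
  end.

(** Branches on the value of the first variable; [pmap (step b)] discards the vectors that
    contradict the branch. A vector reduced to [[::]] has no requirement left, which closes the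
    branch at once. *)
Fixpoint tautology (n : nat) (ss : seq (seq (option bool))) : bool :=
  has (@nilp _) ss ||
  (if n is n'.+1 then
     tautology n' (pmap (step true) ss) && tautology n' (pmap (step false) ss)
   else false).

Fixpoint matches (bs : seq bool) (s : seq (option bool)) : bool :=
  match s, bs with
  | [::], _ => true
  | o :: s', b :: bs' => (if o is Some c then c == b else true) && matches bs' s'
  | _ :: _, [::] => false
  end.

Lemma tautologyP n ss bs :
  size bs = n -> tautology n ss -> exists2 s, s \in ss & matches bs s.
Proof.
elim: n ss bs => [|n IHn] ss bs sz /= /orP[/hasP[s ss_s /nilP s0]|];
  try by exists s => //; rewrite s0; case: (bs).
  by [].
case: bs sz => // b bs [sz] /andP[Ht Hf].
have: tautology n (pmap (step b) ss) by case: b.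
case/(IHn _ _ sz) => s; rewrite mem_pmap => /mapP[s0 s0ss def_s] ms.
exists s0 => //; case: s0 def_s {s0ss} => [|[c|] s0] //=.
  by case: eqP => //= _ [<-].
by case=> <-.
Qed.

Definition encode (vs : seq (nat * nat)) (t : term) : seq (option bool) :=
  trim [seq if v \in t.1 then Some true else
            if v \in t.2 then Some false else None | v <- vs].

(** Ensures that [encode] loses nothing: it would forget a pair outside [vs], and would read a pair
    occurring in both parts as positive only. *)
Definition encodable (vs : seq (nat * nat)) (t : term) : bool :=
  [&& all (mem vs) t.1, all (mem vs) t.2 & ~~ has (mem t.1) t.2].

Lemma matches_trim bs s : size bs = size s -> matches bs (trim s) = matches bs s.
Proof.
elim: s bs => [|o s IHs] [|b bs] //= [sz].
rewrite -(IHs _ sz); case: o => [c|] //=.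
by case: (trim s) => //; case: bs sz.
Qed.

Lemma sat_encode a vs t :
  encodable vs t -> matches [seq a v.1 v.2 | v <- vs] (encode vs t) -> sat a t.
Proof.
case/and3P=> /allP pv /allP nv /hasPn dis;
  rewrite /encode matches_trim ?size_map //.
move=> mt.
have mP v : v \in vs -> if v \in t.1 then a v.1 v.2 else
    if v \in t.2 then ~~ a v.1 v.2 else true.
  elim: vs mt {pv nv} => //= w vs IHvs /andP[h1 h2].
  rewrite inE => /orP[/eqP->|]; last exact: IHvs.
  by move: h1; case: (w \in t.1) => [/eqP<- //|]; case: (w \in t.2) => // /eqP<-.
apply/andP; split; apply/allP=> v vt.
  by have := mP v (pv v vt); rewrite vt.
have := mP v (nv v vt); rewrite vt; have := dis v vt; rewrite /=.
by case: (v \in t.1).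
Qed.

Definition covers (vs : seq (nat * nat)) (ts : seq term) : bool :=
  all (encodable vs) ts && tautology (size vs) [seq encode vs t | t <- ts].

Lemma coversP a vs ts : covers vs ts -> exists2 t, t \in ts & sat a t.
Proof.
case/andP=> /allP enc /(tautologyP (size_map (fun v => a v.1 v.2) vs)).
case=> s /mapP[t tts ->] /(sat_encode (enc t tts)) st.
by exists t.
Qed.

End Tautology.

(* Labels [vs] of the vertices to isolate, triangles [ts] of the packing, pairs
   [es] of the hitting set besides the sides of [ts] that avoid [vs], and pairs
   [ms] assumed not to be edges. *)
Definition reduction :=
  (seq nat * seq (nat * nat * nat) * seq (nat * nat) * seq (nat * nat))%type.

Definition Red vs ts es ms : reduction := (vs, ts, es, ms).
Definition removed (r : reduction) := r.1.1.1.
Definition packed (r : reduction) := r.1.1.2.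
Definition extra (r : reduction) := r.1.2.
Definition missing (r : reduction) := r.2.

Definition sides (t : nat * nat * nat) : seq (nat * nat) :=
  let: (i, j, k) := t in [:: (i, j); (i, k); (j, k)].

(** The deleted set [D] will consist of these pairs and of all edges at the removed vertices. A side
    of a packed triangle that avoids the removed vertices can lie in [D] only through the hitting
    set. *)
Definition hitting (r : reduction) : seq (nat * nat) :=
  extra r ++ [seq p <- flatten [seq sides t | t <- packed r] |
    (p.1 \notin removed r) && (p.2 \notin removed r)].

(* [rows] holds the rows of the adjacency matrix that are given in advance. *)
Definition known (rows : seq bitseq) (b : bool) (p : nat * nat) : bool :=
  (p.1 < size rows) && (nth false (nth [::] rows p.1) p.2 == b).

(* All neighbours of the vertices with labels below [nc] are labelled. *)
Definition valid (n nc : nat) (rows : seq bitseq) (r : reduction) : bool :=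
  let s := hitting r in
  [&& all (gtn nc) (removed r),
      ~~ nilp (packed r),
      all (fun t => let: (i, j, k) := t in [&& i < j, j < k & k < n]) (packed r),
      uniq (flatten [seq sides t | t <- packed r]),
      size s <= 2 * size (packed r) &
      all (fun v => all (fun p => let: (j, k) := p in
         [|| v == j, v == k |
           has (fun p => [|| p \in s, p \in missing r | known rows false p])
             [:: label_pair v j; label_pair v k; (j, k)]])
        (pairs_of (iota 0 n))) (removed r)].

(** Sides that [rows] already declares to be edges are left out, which keeps the number of variables
    of the coverage check small. *)
Definition term_of (rows : seq bitseq) (r : reduction) : term :=
  ([seq p <- flatten [seq sides t | t <- packed r] | ~~ known rows true p],
   missing r).

Definition literals (t : term) := t.1 ++ t.2.

(** The [facts] are the alternatives not settled by a reduction of the table. In an irreducible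
    graph one of them must hold, so a contradiction follows once each of them is refuted by other
    means. *)
Definition exhaustive (n nc : nat) (rows : seq bitseq) (facts : seq term)
    (rs : seq reduction) : bool :=
  let ts := facts ++ [seq term_of rows r | r <- rs] in
  let lits := flatten [seq literals t | t <- ts] in
  all (valid n nc rows) rs &&
  covers [seq p <- pairs_of (iota 0 n) | p \in lits] ts.

Definition star_rows d : seq bitseq := [:: false :: nseq d true].

(* Two children have the labels 0 and 1, followed by their [c] common neighbours,
   the [a] other neighbours of 0 and the [b] other neighbours of 1. *)
Definition pair_rows c a b : seq bitseq :=
  [:: [:: false, false & nseq (c + a) true];
      [:: false, false & nseq c true ++ nseq a false ++ nseq b true]].

Definition pair_link1 c a := iota 2 c ++ iota (2 + c) a.
Definition pair_link2 c a b := iota 2 c ++ iota (2 + c + a) b.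

(* [paths q], [link q] and [isolated q] list terms that fail in an irreducible
   graph when the labels in [q] enumerate the neighbours of a vertex. *)
Definition paths (q : seq nat) : seq term :=
  flatten [seq [seq ([::], [:: label_pair a p.1; label_pair a p.2])
                  | p <- pairs_of [seq x <- q | x != a]] | a <- q].

Definition disjoint_pairs (q : seq nat) :=
  [seq pp <- allpairs pair (pairs_of q) (pairs_of q) |
    uniq [:: pp.1.1; pp.1.2; pp.2.1; pp.2.2]].

Definition link (q : seq nat) : seq term :=
  paths q ++
  (if size q == 5 then [seq ([::], [:: pp.1; pp.2]) | pp <- disjoint_pairs q]
   else flatten [seq [seq ([:: p], [:: pp.1; pp.2])
      | p <- pairs_of [seq x <- q | x \notin [:: pp.1.1; pp.1.2; pp.2.1; pp.2.2]]]
      | pp <- disjoint_pairs q]).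

Definition isolated (q : seq nat) : seq term :=
  [seq ([::], [seq label_pair j k | k <- q & k != j]) | j <- q].

(* The terms refuted by the pairs [ps] being non-edges, respectively edges. *)
Definition absent ps : seq term := [seq ([:: p], [::]) | p <- ps].
Definition present ps : seq term := [seq ([::], [:: p]) | p <- ps].

(** * Soundness of the labelled reductions *)

Lemma uniq_flatten_inj (A B : eqType) (f : A -> seq B) (s : seq A) x t1 t2 :
  uniq (flatten [seq f t | t <- s]) -> t1 \in s -> t2 \in s ->
  x \in f t1 -> x \in f t2 -> t1 = t2.
Proof.
elim: s => //= t s IHs; rewrite cat_uniq => /and3P[_ /hasPn dis us].
have out t' : t' \in s -> x \in f t' -> x \notin f t.
  by move=> t's xt'; apply: dis; apply/flatten_mapP; exists t'.
rewrite !inE => /orP[/eqP->|t1s] /orP[/eqP->|t2s] // x1 x2; last exact: IHs.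
  by have := out _ t2s x2; rewrite x1.
by have := out _ t1s x1; rewrite x2.
Qed.

Lemma uniq_of_flatten (A B : eqType) (f : A -> seq B) (s : seq A) :
  (forall t, f t != [::]) -> uniq (flatten [seq f t | t <- s]) -> uniq s.
Proof.
move=> f0; elim: s => //= t s IHs; rewrite cat_uniq => /and3P[_ /hasPn dis us].
rewrite IHs // andbT; apply/negP=> ts; case ft: (f t) (f0 t) => [|x q] // _.
have /dis: x \in flatten [seq f t | t <- s].
  by apply/flatten_mapP; exists t; rewrite // ft inE eqxx.
by rewrite /= ft inE eqxx.
Qed.

Section Local.
Variables (T : finType) (e : rel T) (x0 : T) (l : seq T).
Hypotheses (sg : simple_graph e) (ul : uniq l).

(** Labels beyond the end of [l] behave as isolated vertices, so a table for [n] labels also applies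
    to shorter lists. *)
Definition adj i j := [&& i < size l, j < size l & e (nth x0 l i) (nth x0 l j)].

Lemma adjC i j : adj i j = adj j i.
Proof. by rewrite /adj; case: sg => sym _; rewrite sym andbCA. Qed.

Lemma adjii i : adj i i = false.
Proof. by rewrite /adj; case: sg => _ ->; rewrite !andbF. Qed.

Lemma adj_label i j : adj (label_pair i j).1 (label_pair i j).2 = adj i j.
Proof. by rewrite /label_pair; case: ltnP => _ //=; rewrite adjC. Qed.

Let edge_of (p : nat * nat) : {set T} := [set nth x0 l p.1; nth x0 l p.2].
Let tri_of (t : nat * nat * nat) : {set T} :=
  [set nth x0 l t.1.1; nth x0 l t.1.2; nth x0 l t.2].

Lemma edge_of_inj p q : p.1 < p.2 -> q.1 < q.2 ->
  p.2 < size l -> q.2 < size l -> edge_of p = edge_of q -> p = q.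
Proof.
case: p q => [i j] [k m] /= ij km jl ml /setP eqE.
have il := ltn_trans ij jl; have kl := ltn_trans km ml.
have := eqE (nth x0 l i); rewrite !inE eqxx /= !nth_uniq // => /esym/orP[]/eqP hi;
have := eqE (nth x0 l j); rewrite !inE eqxx orbT /= !nth_uniq // =>
  /esym/orP[]/eqP hj;
by subst; rewrite ?ltnn // in ij *; have := ltn_trans ij km; rewrite ltnn.
Qed.

Lemma edge_of_label i j : edge_of (label_pair i j) = [set nth x0 l i; nth x0 l j].
Proof. by rewrite /label_pair /edge_of; case: ltnP => _ //=; rewrite setUC. Qed.

Variables (n nc : nat) (rows : seq bitseq).
Hypotheses (szl : size l <= n) (ncl : nc <= size l).
Hypothesis closed : forall i y, i < nc -> e (nth x0 l i) y -> y \in l.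
Hypothesis rowsP : forall i j, i < size rows -> j < n ->
  adj i j = nth false (nth [::] rows i) j.

Lemma knownP b p : p.2 < n -> known rows b p -> adj p.1 p.2 = b.
Proof. by move=> p2 /andP[p1 /eqP <-]; apply: rowsP. Qed.

(** Take for [S] the edges labelled by the hitting set and for [D] these together with all edges at
    removed vertices. A triangle that meets [D] outside [S] contains a removed vertex, so by
    [closed] all its vertices are labelled. For such a triangle [valid] has checked that one of the
    three pairs is in the hitting set or is no edge, and the latter is impossible. *)
Lemma reduction_sound r :
  valid n nc rows r -> sat adj (term_of rows r) -> reducible e.
Proof.
case/and5P=> /allP rem_nc pack0 /allP packn upack /andP[sz_hit /allP hits].
case/andP=> /allP /= pos /allP /= neg.
set s := hitting r in sz_hit hits.
have sides_n t p : t \in packed r -> p \in sides t -> (p.1 < p.2) && (p.2 < n).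
  case: t => [[i j] k] /packn /and3P[ij jk kn].
  by rewrite !inE => /or3P[]/eqP->;
    rewrite /= ?ij ?jk ?kn ?(ltn_trans ij jk) ?(ltn_trans jk kn).
have adj_side t p : t \in packed r -> p \in sides t -> adj p.1 p.2.
  move=> tr pt; have /andP[_ pn] := sides_n t p tr pt.
  have [kp|nkp] := boolP (known rows true p); first by rewrite (knownP pn kp).
  by apply: pos; rewrite mem_filter nkp; apply/flatten_mapP; exists t.
have side_l t p : t \in packed r -> p \in sides t -> p.2 < size l.
  by move=> tr pt; case/and3P: (adj_side t p tr pt).
have edge_side t p : t \in packed r -> p \in sides t -> edge_of p \in edges e.
  move=> tr pt; case/and3P: (adj_side t p tr pt) => _ _ epp.
  by apply/edgesP; exists (nth x0 l p.1), (nth x0 l p.2).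
have tri_side t p : p \in sides t -> edge_of p \subset tri_of t.
  case: t => [[i j] k]; rewrite !inE => /or3P[]/eqP->; apply/subsetP=> w;
  by rewrite !inE => /orP[]->; rewrite ?orbT.
have side_tri t E : E \in tri_edges e (tri_of t) ->
  exists2 p, p \in sides t & E = edge_of p.
  case: t => [[i j] k] /(tri_edgesE sg)[]->.
  - by exists (i, j); rewrite ?inE ?eqxx.
  - by exists (j, k); rewrite ?inE ?eqxx ?orbT.
  by exists (i, k); rewrite ?inE ?eqxx ?orbT.
(* A common edge has the same increasing label pair in both triangles, and no pair is repeated among
   the sides of the packed triangles. *)
have share t1 t2 E : t1 \in packed r -> t2 \in packed r ->
    E \in tri_edges e (tri_of t1) -> E \in tri_edges e (tri_of t2) -> t1 = t2.
  move=> t1r t2r /side_tri[p pt1 ->] /side_tri[q qt2 /edge_of_inj pq].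
  have /andP[pp _] := sides_n _ _ t1r pt1; have /andP[qq _] := sides_n _ _ t2r qt2.
  have {}pq := pq pp qq (side_l _ _ t1r pt1) (side_l _ _ t2r qt2).
  by rewrite -pq in qt2; apply: uniq_flatten_inj upack t1r t2r pt1 qt2.
pose S := [set E in edges e | E \in [seq edge_of p | p <- s]].
pose D := S :|: [set E in edges e | has (fun v => nth x0 l v \in E) (removed r)].
have inS E : (E \in S) = (E \in edges e) && (E \in [seq edge_of p | p <- s]).
  by rewrite in_set.
have inD E : (E \in D) = (E \in S) ||
    (E \in edges e) && has (fun v => nth x0 l v \in E) (removed r).
  by rewrite in_setU [X in _ || X]in_set.
pose P := [set E in [seq tri_of t | t <- packed r]].
have PE t : t \in P -> exists2 u, u \in packed r & t = tri_of u.
  by rewrite inE => /mapP[u ur ->]; exists u.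
have P_D t : t \in P -> tri_edges e t \subset D.
  case/PE=> u ur ->; apply/subsetP=> E /side_tri[p pu ->].
  rewrite inD inS (edge_side u p ur pu) /=.
  have [p1|np1] := boolP (p.1 \in removed r).
    by apply/orP; right; apply/hasP; exists p.1; rewrite // !inE eqxx.
  have [p2|np2] := boolP (p.2 \in removed r).
    by apply/orP; right; apply/hasP; exists p.2; rewrite // !inE eqxx orbT.
  apply/orP; left; apply/mapP; exists p => //;
    rewrite /s /hitting mem_cat mem_filter np1 np2.
  by apply/orP; right; apply/flatten_mapP; exists u.
have sides0 t : exists2 p, p \in sides t & sides t != [::].
  by case: t => [[i j] k]; exists (i, j); rewrite // inE eqxx.
have packP : triangle_packing e P.
  apply/andP; split.
    apply/subsetP=> t /PE[[[i j] k] ur ->]; apply/trianglesP.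
    have adjE p : p \in sides (i, j, k) -> e (nth x0 l p.1) (nth x0 l p.2).
      by case/(adj_side _ _ ur)/and3P.
    exists (nth x0 l i), (nth x0 l j), (nth x0 l k).
    split=> //; [apply: (adjE (i, j))|apply: (adjE (j, k))|apply: (adjE (i, k))];
    by rewrite !inE eqxx ?orbT.
  apply/forallP=> t; apply/implyP=> /PE[u ur ->].
  apply/forallP=> t'; apply/implyP=> /PE[u' ur' ->]; apply/implyP=> ne.
  apply/pred0P=> E /=; apply/negP=> /andP[Eu Eu'].
  by case/eqP: ne; congr tri_of; apply: share Eu Eu'.
(* Packed triangles with equal vertex sets share an edge, hence are the same entry; so [tri_of] is
   injective on them. *)
have cardP : #|P| = size (packed r).
  rewrite cardsE -(size_map tri_of); apply/card_uniqP; rewrite map_inj_in_uniq.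
    by apply: uniq_of_flatten upack => t; case: (sides0 t).
  move=> t t' tr t'r eqt; have [p pt _] := sides0 t.
  have: edge_of p \in tri_edges e (tri_of t).
    by rewrite in_set (edge_side _ _ tr pt) tri_side.
  by move=> pe; apply: (share _ _ (edge_of p)) => //; rewrite -eqt.
exists D, S, P; split; split=> //.
- case pk: (packed r) pack0 => [|t q] // _;
    have tr: t \in packed r by rewrite pk inE eqxx.
  have [p pt _] := sides0 t; apply/set0Pn; exists (edge_of p).
  apply: (subsetP (P_D (tri_of t) _)); first by rewrite inE map_f.
  by rewrite in_set (edge_side _ _ tr pt) tri_side.
- by apply/subsetP=> E; rewrite inD inS => /orP[]/andP[].
- exact: subsetUl.
- rewrite cardP; apply: leq_trans sz_hit; rewrite -(size_map edge_of).
  apply: leq_trans (card_size _); apply: subset_leq_card; apply/subsetP=> E.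
  by rewrite inS inE => /andP[].
move=> t tt /pred0Pn[E /= /andP[Et ED]].
have [ES|nES] := boolP (E \in S).
  by exists E => //; move: Et; rewrite inE => /andP[].
move: ED; rewrite inD (negPf nES) /= => /andP[_ /hasP[v vr vE]].
have vnc : v < nc := rem_nc v vr; have vl := leq_trans vnc ncl.
(* Rearrange the triangle so that the removed vertex comes first. *)
have [y [z [evy evz eyz def_t]]]:
    exists y z, [/\ e (nth x0 l v) y, e (nth x0 l v) z, e y z & t = [set nth x0
      l v; y; z]].
  have vt : nth x0 l v \in t by apply: subsetP vE; move: Et; rewrite inE => /andP[].
  have [sym _] := sg.
  case/trianglesP: tt vt => x [y [z [exy eyz exz ->]]].
  rewrite !inE => /orP[/orP[]|] /eqP->.
  - by exists y, z.
  - by exists x, z; rewrite sym; split=> //; rewrite (setUC [set y]).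
  by exists x, y; rewrite ![e z _]sym; split=> //; rewrite setUC setUA.
have hit_jk j k : j < k -> k < size l -> e (nth x0 l v) (nth x0 l j) ->
    e (nth x0 l v) (nth x0 l k) -> e (nth x0 l j) (nth x0 l k) ->
    exists2 F, F \in S & F \subset [set nth x0 l v; nth x0 l j; nth x0 l k].
  move=> jk kl evj evk ejk; have jl := ltn_trans jk kl.
  have := hits v vr; rewrite -/s => /allP/(_ (j, k)).
  have kn := leq_trans kl szl.
  rewrite mem_filter /= jk allpairs_f ?mem_iota ?(leq_trans jl szl) // => /(_ isT).
  have avj : adj v j by rewrite /adj vl jl.
  have avk : adj v k by rewrite /adj vl kl.
  have ajk : adj j k by rewrite /adj jl kl.
  case/or3P=> [/eqP vj|/eqP vk|]; first by rewrite vj adjii in avj.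
    by rewrite vk adjii in avk.
  have use p : adj p.1 p.2 -> p.2 < n ->
      edge_of p \subset [set nth x0 l v; nth x0 l j; nth x0 l k] ->
      [|| p \in s, p \in missing r | known rows false p] ->
      exists2 F, F \in S & F \subset [set nth x0 l v; nth x0 l j; nth x0 l k].
    move=> ap pn sub /or3P[ps|pm|/(knownP pn)]; last by rewrite ap.
      exists (edge_of p) => //; rewrite inS map_f // andbT.
      by apply/edgesP; exists (nth x0 l p.1), (nth x0 l p.2); case/and3P: ap.
    by have := neg p pm; rewrite ap.
  have lab_n i m : i < n -> m < n -> (label_pair i m).2 < n.
    by rewrite /label_pair; case: ifP.
  have vn := leq_trans vl szl; have jn := leq_trans jl szl.
  case/or4P=> // [h|h|h]; apply: use h; rewrite ?adj_label ?lab_n ?edge_of_label //;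
    by apply/subsetP=> w; rewrite !inE => /orP[]->; rewrite ?orbT.
have yl : y \in l := closed vnc evy; have zl : z \in l := closed vnc evz.
move: evy evz eyz; rewrite def_t -(nth_index x0 yl) -(nth_index x0 zl).
set j := index y l; set k := index z l => evj evk ejk.
(* The table check only ranges over increasing pairs, so the two remaining vertices are sorted by
   label. *)
case: (ltngtP j k) => [jk|kj|jk].
- by apply: hit_jk; rewrite // index_mem.
- have [sym _] := sg; have jl : j < size l by rewrite index_mem.
  rewrite sym in ejk; have [F FS Ft] := hit_jk k j kj jl evk evj ejk.
  by exists F => //; rewrite -setUA [[set nth x0 l j] :|: _]setUC setUA.
by have [_ irr] := sg; rewrite jk irr in ejk.
Qed.

End Local.

(** * Tables of reductions *)

(* The tables were found by computer search.  They are checked by [lazy] because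
   call-by-value evaluation would not stop at the first true disjunct in
   [tautology]. *)

Definition star1_table : seq reduction := [::].

(** A single neighbour is isolated in the link; the corresponding fact is the empty term, which
    covers everything by itself. *)
Lemma exhaustive_star1 : exhaustive 2 1 (star_rows 1)
  (isolated (iota 1 1)) star1_table.
Proof. by lazy. Qed.

Definition star2_table : seq reduction := [::
  Red [:: 0] [:: (0,1,2)] [::] [::]].

Lemma exhaustive_star2 : exhaustive 3 1 (star_rows 2)
  (isolated (iota 1 2)) star2_table.
Proof. by lazy. Qed.

Definition star3_table : seq reduction := [::
  Red [:: 0] [:: (0,1,3)] [:: (0,2)] [::];
  Red [:: 0] [:: (0,1,2)] [:: (2,3)] [:: (1,3)]].

Lemma exhaustive_star3 : exhaustive 4 1 (star_rows 3)
  (isolated (iota 1 3)) star3_table.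
Proof. by lazy. Qed.

Definition star4_table : seq reduction := [::
  Red [:: 0] [:: (0,1,3); (0,2,4)] [:: (1,2); (0,4)] [:: (2,3)];
  Red [:: 0] [:: (0,1,2); (0,3,4)] [:: (0,2)] [:: (1,3); (1,4)];
  Red [:: 0] [:: (0,1,3); (0,2,4)] [:: (1,2); (0,3)] [:: (1,4)];
  Red [:: 0] [:: (0,1,2)] [:: (0,1)] [:: (2,3); (2,4); (3,4)];
  Red [:: 0] [:: (0,1,2)] [:: (0,4)] [:: (1,3); (2,3)];
  Red [:: 0] [:: (0,1,4)] [:: (0,4)] [:: (1,2); (1,3); (2,3)];
  Red [:: 0] [:: (0,2,3); (0,1,4)] [:: (0,2); (0,3)] [::];
  Red [:: 0] [:: (0,1,2)] [:: (0,3)] [:: (1,4); (2,4)];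
  Red [:: 0] [:: (0,2,4)] [:: (0,2)] [:: (1,3); (1,4); (3,4)];
  Red [:: 0] [:: (0,2,3)] [:: (0,3)] [:: (1,2); (1,4); (2,4)];
  Red [:: 0] [:: (0,1,2); (0,3,4)] [:: (0,1)] [:: (2,3); (2,4)]].

Lemma exhaustive_star4 : exhaustive 5 1 (star_rows 4)
  (isolated (iota 1 4)) star4_table.
Proof. by lazy. Qed.

(** Vertex 1 is not adjacent to 2 and 3: the complement of the link contains a path with centre 1.
    The [absent] facts stand for the cases where one of these two pairs is an edge after all. *)
Definition star5_path_table : seq reduction := [::
  Red [:: 0] [:: (0,2,3); (0,1,4)] [:: (0,4); (0,5)] [:: (1,2); (1,3)];
  Red [:: 0] [:: (0,1,4)]
    [:: (0,4)] [:: (1,2); (1,3); (2,3); (1,5); (2,5); (3,5)];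
  Red [:: 0] [:: (0,2,4); (0,1,5)] [:: (0,4); (0,5)] [:: (1,2); (1,3); (2,3)];
  Red [:: 0] [:: (0,3,4); (0,2,5)]
    [:: (0,5)] [:: (1,2); (1,3); (2,3); (1,4); (2,4)];
  Red [:: 0] [:: (0,2,3); (0,1,5)] [:: (0,4); (0,5)] [:: (1,2); (1,3)];
  Red [:: 0] [:: (0,2,5)]
    [:: (0,5)] [:: (1,2); (1,3); (2,3); (1,4); (2,4); (3,4)];
  Red [:: 0] [:: (0,1,4); (0,2,5)] [:: (0,4); (0,5)] [:: (1,2); (1,3); (2,3)];
  Red [:: 0] [:: (0,1,4); (0,3,5)]
    [:: (0,4)] [:: (1,2); (1,3); (2,3); (1,5); (2,5)]].

Lemma exhaustive_star5_path : exhaustive 6 1 (star_rows 5)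
  (absent [:: (1,2); (1,3)] ++ isolated (iota 1 5)) star5_path_table.
Proof. by lazy. Qed.

Definition star6_path_table : seq reduction := [::
  Red [:: 0] [:: (0,2,3); (0,1,4); (0,5,6)]
    [:: (0,3); (0,4)] [:: (1,2); (1,5); (2,5); (1,6); (2,6)];
  Red [:: 0] [:: (0,2,3); (0,1,4); (2,4,5)]
    [:: (0,6)] [:: (1,2); (1,3); (3,4); (1,5); (3,5)];
  Red [:: 0] [:: (0,2,3); (0,1,4); (0,5,6)]
    [:: (0,1); (0,2)] [:: (3,4); (3,5); (4,5); (3,6); (4,6)];
  Red [:: 0] [:: (0,2,3); (0,1,5)]
    [:: (0,5); (0,6)] [:: (1,2); (1,3); (1,4); (2,4); (3,4)];
  Red [:: 0] [:: (0,1,4); (0,3,5)]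
    [:: (0,4); (0,5)] [:: (1,2); (1,3); (2,3); (1,6); (2,6); (3,6)];
  Red [:: 0] [:: (0,2,4); (0,3,5); (0,1,6)]
    [:: (0,3); (0,4); (0,6)] [:: (1,2); (1,5); (2,5)];
  Red [:: 0] [:: (0,1,4); (0,2,6)]
    [:: (0,4); (0,6)] [:: (1,2); (1,3); (2,3); (1,5); (2,5); (3,5)];
  Red [:: 0] [:: (0,2,3); (0,1,4)]
    [:: (0,4); (0,6)] [:: (1,2); (1,3); (1,5); (2,5); (3,5)];
  Red [:: 0] [:: (0,4,5); (0,3,6)]
    [:: (0,2); (0,6)] [:: (1,3); (1,4); (3,4); (1,5); (3,5)];
  Red [:: 0] [:: (0,2,3); (0,1,5)]
    [:: (0,3); (0,5)] [:: (1,2); (1,4); (2,4); (1,6); (2,6); (4,6)];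
  Red [:: 0] [:: (0,2,3); (0,1,4)]
    [:: (0,5); (0,6)] [:: (1,2); (1,3); (2,4); (3,4)];
  Red [:: 0] [:: (0,2,3); (0,1,5); (0,4,6)]
    [:: (0,2); (0,4); (5,6)] [:: (1,3); (3,5); (1,6); (3,6)];
  Red [:: 0] [:: (0,2,3); (0,1,4)]
    [:: (0,3); (0,5)] [:: (1,2); (2,4); (1,6); (2,6); (4,6)];
  Red [:: 0] [:: (0,2,4); (0,3,5)]
    [:: (0,4); (0,6)] [:: (1,2); (1,3); (2,3); (1,5); (2,5)];
  Red [:: 0] [:: (0,1,4); (0,2,6)]
    [:: (0,5); (0,6)] [:: (1,2); (1,3); (2,3); (2,4); (3,4)];
  Red [:: 0] [:: (0,2,4); (0,1,5); (0,3,6)]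
    [:: (0,2); (0,5); (0,6)] [:: (1,3); (1,4); (3,4)];
  Red [:: 0] [:: (0,3,4); (0,1,5)]
    [:: (0,4); (0,5)] [:: (1,2); (1,3); (2,3); (1,6); (2,6); (3,6)];
  Red [:: 0] [:: (0,3,4); (0,5,6)]
    [:: (0,2); (0,4)] [:: (1,3); (1,5); (3,5); (1,6); (3,6)];
  Red [:: 0] [:: (0,2,5); (0,3,6)]
    [:: (0,5); (0,6)] [:: (1,2); (1,3); (2,3); (1,4); (2,4); (3,4)];
  Red [:: 0] [:: (0,3,4); (0,1,5); (2,3,5); (0,2,6)]
    [:: (0,4); (0,6)] [:: (1,2); (1,3)];
  Red [:: 0] [:: (0,3,6)]
    [:: (0,6)] [:: (1,2); (1,3); (2,3); (1,4); (2,4); (3,4); (1,5); (2,5);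
      (3,5); (4,5)];
  Red [:: 0] [:: (0,2,3); (0,1,5); (0,4,6)]
    [:: (0,3); (1,4); (0,5)] [:: (1,2); (2,4); (1,6); (2,6)];
  Red [:: 0] [:: (0,3,5); (0,1,6)]
    [:: (0,3); (0,6)] [:: (1,2); (1,4); (2,4); (1,5); (2,5); (4,5)];
  Red [:: 0] [:: (0,2,3); (0,1,6)]
    [:: (0,4); (0,6)] [:: (1,2); (1,3); (1,5); (2,5); (3,5)];
  Red [:: 0] [:: (0,3,4); (0,1,5); (0,2,6)]
    [:: (0,2); (0,4); (0,6)] [:: (1,3); (3,5)];
  Red [:: 0] [:: (0,2,3); (0,1,5); (0,4,6)]
    [:: (0,1); (0,2); (5,6)] [:: (3,4); (3,5); (4,5); (3,6)];
  Red [:: 0] [:: (0,2,5); (0,1,6)]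
    [:: (0,5); (0,6)] [:: (1,2); (1,3); (2,3); (1,4); (2,4); (3,4)];
  Red [:: 0] [:: (0,1,4); (0,2,5)]
    [:: (0,4); (0,6)] [:: (1,2); (1,3); (2,3); (1,5); (3,5)];
  Red [:: 0] [:: (0,2,4); (0,1,5)]
    [:: (0,1); (0,2)] [:: (3,4); (3,5); (4,5); (3,6); (4,6); (5,6)];
  Red [:: 0] [:: (0,2,3); (0,1,4)]
    [:: (0,3); (0,4)] [:: (1,2); (1,5); (2,5); (1,6); (2,6); (5,6)];
  Red [:: 0] [:: (0,1,4); (2,3,4); (0,2,5)]
    [:: (0,6)] [:: (1,2); (1,3); (1,5); (3,5); (4,5)];
  Red [:: 0] [:: (0,2,4); (0,3,6)]
    [:: (0,4); (5,6)] [:: (1,2); (1,3); (2,3); (1,5); (2,5); (3,5); (1,6); (2,6)];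
  Red [:: 0] [:: (0,2,4); (0,1,5); (0,3,6)]
    [:: (2,3); (0,4); (0,5)] [:: (1,2); (1,3); (1,6); (2,6)];
  Red [:: 0] [:: (0,1,4); (0,2,5)]
    [:: (0,2); (0,5)] [:: (1,3); (3,4); (1,6); (3,6); (4,6)];
  Red [:: 0] [:: (0,2,4); (0,3,5)]
    [:: (0,2); (0,5)] [:: (1,3); (1,4); (3,4); (1,6); (3,6); (4,6)];
  Red [:: 0] [:: (0,3,4); (0,2,5); (0,1,6)]
    [:: (0,3); (0,4); (0,6)] [:: (1,2); (1,5)];
  Red [:: 0] [:: (0,3,5); (0,1,6)]
    [:: (4,5); (0,6)] [:: (1,2); (1,3); (2,3); (1,4); (2,4); (3,4); (1,5); (2,5)];
  Red [:: 0] [:: (0,1,4); (0,2,5)]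
    [:: (0,3); (0,6)] [:: (1,2); (2,4); (1,5); (4,5)];
  Red [:: 0] [:: (0,1,4); (0,2,5)]
    [:: (0,5); (0,6)] [:: (1,2); (1,3); (2,3); (2,4); (3,4)];
  Red [:: 0] [:: (0,1,4); (0,2,5); (0,3,6)]
    [:: (0,2); (0,5); (0,6)] [:: (1,3); (3,4)];
  Red [:: 0] [:: (0,2,3); (0,1,5)]
    [:: (0,3); (0,6)] [:: (1,2); (1,4); (2,4); (2,5); (4,5)];
  Red [:: 0] [:: (0,4,5)]
    [:: (0,5)] [:: (1,2); (1,3); (2,3); (1,4); (2,4); (3,4); (1,6); (2,6);
      (3,6); (4,6)];
  Red [:: 0] [:: (0,3,4); (0,1,5)]
    [:: (0,5); (0,6)] [:: (1,2); (1,3); (2,3); (1,4); (2,4)];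
  Red [:: 0] [:: (0,1,4); (0,2,5); (0,3,6)]
    [:: (2,3); (0,4); (0,5)] [:: (1,2); (1,3); (1,6); (2,6)];
  Red [:: 0] [:: (0,2,4); (0,1,6)]
    [:: (0,4); (0,6)] [:: (1,2); (1,3); (2,3); (1,5); (2,5); (3,5)];
  Red [:: 0] [:: (0,4,5); (0,3,6)]
    [:: (0,3); (0,6)] [:: (1,2); (1,4); (2,4); (1,5); (2,5)];
  Red [:: 0] [:: (0,3,5); (0,4,6)]
    [:: (0,2); (0,5)] [:: (1,3); (1,4); (3,4); (1,6); (3,6)];
  Red [:: 0] [:: (0,3,4); (0,1,5); (0,2,6)]
    [:: (0,3); (0,4); (0,6)] [:: (1,2); (2,5)];
  Red [:: 0] [:: (0,1,5); (0,2,6)]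
    [:: (0,5); (0,6)] [:: (1,2); (1,3); (2,3); (1,4); (2,4); (3,4)];
  Red [:: 0] [:: (0,1,4); (0,3,5); (0,2,6)]
    [:: (0,2); (0,5); (0,6)] [:: (1,3); (3,4)];
  Red [:: 0] [:: (0,1,4); (0,2,5)]
    [:: (0,2); (0,6)] [:: (1,3); (3,4); (1,5); (3,5); (4,5)];
  Red [:: 0] [:: (0,2,3); (0,1,4); (0,5,6)]
    [:: (0,1); (0,3)] [:: (2,4); (2,5); (4,5); (2,6); (4,6)];
  Red [:: 0] [:: (0,4,5); (0,2,6)]
    [:: (0,2); (0,4)] [:: (1,3); (1,5); (3,5); (1,6); (3,6); (5,6)];
  Red [:: 0] [:: (0,2,3); (0,1,5)]
    [:: (0,4); (0,6)] [:: (1,2); (1,3); (2,5); (3,5)];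
  Red [:: 0] [:: (0,2,3); (0,4,5); (0,1,6)]
    [:: (0,4); (0,5); (3,6)] [:: (1,2); (1,3); (2,6)];
  Red [:: 0] [:: (0,1,4); (0,2,5); (0,3,6)]
    [:: (2,3); (0,4); (0,6)] [:: (1,2); (1,3); (1,5); (3,5)];
  Red [:: 0] [:: (0,1,4); (0,3,5)]
    [:: (0,3); (0,6)] [:: (1,2); (2,4); (1,5); (2,5); (4,5)];
  Red [:: 0] [:: (0,2,3); (0,1,6)]
    [:: (0,5); (0,6)] [:: (1,2); (1,3); (1,4); (2,4); (3,4)];
  Red [:: 0] [:: (0,3,4); (0,1,6)]
    [:: (0,5); (0,6)] [:: (1,2); (1,3); (2,3); (1,4); (2,4)];
  Red [:: 0] [:: (0,2,4); (0,1,5)]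
    [:: (0,4); (0,6)] [:: (1,2); (1,3); (2,3); (2,5); (3,5)];
  Red [:: 0] [:: (0,1,4)]
    [:: (0,4)] [:: (1,2); (1,3); (2,3); (1,5); (2,5); (3,5); (1,6); (2,6);
      (3,6); (5,6)];
  Red [:: 0] [:: (0,2,3); (0,4,5); (0,1,6)]
    [:: (0,4); (0,5); (2,6)] [:: (1,2); (1,3); (3,6)];
  Red [:: 0] [:: (0,2,3); (0,1,6)]
    [:: (0,2); (0,6)] [:: (1,3); (1,4); (3,4); (1,5); (3,5); (4,5)];
  Red [:: 0] [:: (0,2,3); (0,1,5)]
    [:: (0,4); (0,5)] [:: (1,2); (1,3); (1,6); (2,6); (3,6)];
  Red [:: 0] [:: (0,2,3); (0,1,5); (2,4,5)]
    [:: (0,6)] [:: (1,2); (1,3); (1,4); (3,4); (3,5)];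
  Red [:: 0] [:: (0,2,4); (0,3,5); (0,1,6)]
    [:: (0,3); (0,4); (0,5)] [:: (1,2); (2,6)];
  Red [:: 0] [:: (0,2,4); (0,1,5)]
    [:: (0,2); (0,6)] [:: (1,3); (1,4); (3,4); (3,5); (4,5)];
  Red [:: 0] [:: (0,3,4); (0,1,5); (0,2,6)]
    [:: (0,4); (0,5); (0,6)] [:: (1,2); (1,3); (2,3)];
  Red [:: 0] [:: (0,2,4); (0,1,6)]
    [:: (0,5); (0,6)] [:: (1,2); (1,3); (2,3); (1,4); (3,4)];
  Red [:: 0] [:: (0,1,4); (0,3,5)]
    [:: (0,1); (0,3)] [:: (2,4); (2,5); (4,5); (2,6); (4,6); (5,6)];
  Red [:: 0] [:: (0,2,3); (0,1,4)]
    [:: (0,4); (0,5)] [:: (1,2); (1,3); (1,6); (2,6); (3,6)];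
  Red [:: 0] [:: (0,3,4); (0,2,5); (0,1,6)]
    [:: (0,3); (0,4); (0,5)] [:: (1,2); (2,6)];
  Red [:: 0] [:: (0,2,4); (0,3,5); (0,1,6)]
    [:: (2,3); (0,5); (0,6)] [:: (1,2); (1,3); (1,4); (3,4)];
  Red [:: 0] [:: (0,2,3); (0,1,5); (0,4,6)]
    [:: (0,3); (1,4); (0,6)] [:: (1,2); (2,4); (2,5); (4,5)];
  Red [:: 0] [:: (0,1,4); (0,3,5); (0,2,6)]
    [:: (0,2); (0,4); (0,6)] [:: (1,3); (1,5)]].

Lemma exhaustive_star6_path : exhaustive 7 1 (star_rows 6)
  (absent [:: (1,2); (1,3)] ++ isolated (iota 1 6)) star6_path_table.
Proof. by lazy. Qed.

(** When the non-edges of the link are exactly 12 and 34, its eight edges are all sides of the four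
    packed triangles; together they hit every triangle at vertex 0. *)
Definition star5_matching_table : seq reduction := [::
  Red [:: 0] [:: (0,1,3); (0,2,4); (2,3,5); (1,4,5)] [::] [:: (1,2); (3,4)]].

Lemma exhaustive_star5_matching : exhaustive 6 1 (star_rows 5)
  (absent [:: (1,2); (3,4)] ++ paths (iota 1 5)) star5_matching_table.
Proof. by lazy. Qed.

Definition star6_matching_table : seq reduction := [::
  Red [:: 0] [:: (0,2,3); (0,1,4); (1,3,5); (2,4,5); (0,5,6)]
    [:: (0,6)] [:: (1,2); (3,4)]].

Lemma exhaustive_star6_matching : exhaustive 7 1 (star_rows 6)
  (absent [:: (1,2); (3,4)] ++ present [:: (5,6)] ++ paths (iota 1 6))
    star6_matching_table.
Proof. by lazy. Qed.

(** Label 0 is the only child and label 1 its parent. Labels 1 to 5 are the neighbours of the child,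
    and the last labels are the other vertices that the parent may be adjacent to. *)
Definition child5_table : seq reduction := [::
  Red [:: 0;1] [:: (0,2,3); (1,2,5); (0,4,5); (1,3,7)]
    [:: (0,2); (0,3); (1,5); (1,6)] [:: (1,4); (2,7)];
  Red [:: 1] [:: (0,1,3); (1,4,5)]
    [:: (1,4); (1,5)] [:: (1,2); (3,6); (3,7); (6,7)];
  Red [:: 0;1] [:: (0,2,3); (0,1,5); (1,4,7)]
    [:: (1,2); (0,4); (0,5); (1,5)] [:: (1,3); (4,6); (6,7)];
  Red [:: 0;1] [:: (0,1,2); (0,3,5); (2,4,5); (1,3,7)]
    [:: (1,2); (0,3); (1,5)] [:: (1,4); (3,6); (6,7)];
  Red [:: 0;1] [:: (1,2,4); (0,3,4); (0,1,5); (2,3,5)]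
    [:: (0,1); (4,5); (1,6)] [:: (1,7)];
  Red [:: 0;1] [:: (0,2,3); (0,1,4); (2,4,5); (1,3,6)]
    [:: (0,3); (1,4); (1,5)] [:: (1,2); (3,7); (6,7)];
  Red [:: 1] [:: (0,1,4); (1,2,5)]
    [:: (1,2); (1,5)] [:: (1,3); (4,6); (4,7); (6,7)];
  Red [:: 0;1] [:: (0,3,4); (0,2,5); (1,4,5); (1,3,7)]
    [:: (0,3); (0,4); (1,5); (1,6)] [:: (1,2); (4,7)];
  Red [:: 0;1] [:: (0,1,4); (2,3,4); (1,2,5); (0,3,5); (1,3,7)]
    [:: (0,1); (4,5); (1,6); (1,7)] [::];
  Red [:: 0;1] [:: (0,2,4); (1,3,4); (0,1,5); (2,3,5)]
    [:: (0,1); (1,6); (1,7)] [:: (4,5)];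
  Red [:: 0;1] [:: (0,1,4); (0,3,5); (2,4,5); (1,3,7)]
    [:: (0,3); (1,4); (1,5)] [:: (1,2); (3,6); (6,7)];
  Red [:: 0;1] [:: (0,1,4); (0,2,5); (1,3,7)]
    [:: (1,2); (0,3); (0,4); (1,4)] [:: (1,5); (3,6); (6,7)];
  Red [:: 1] [:: (0,1,5); (1,4,6); (1,2,7)]
    [:: (1,2); (1,4); (1,5)] [:: (1,3); (6,7)];
  Red [:: 0;1] [:: (0,1,3); (0,2,4); (1,2,5); (3,4,5); (1,6,7)]
    [:: (0,1); (2,3); (1,6); (1,7)] [::];
  Red [:: 0;1] [:: (1,2,4); (0,3,4); (0,2,5); (1,3,7)]
    [:: (1,2); (0,3); (0,4); (1,6)] [:: (1,5); (4,7)];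
  Red [:: 1] [:: (0,1,2); (1,4,5); (1,6,7)] [:: (1,2); (1,4); (1,5)] [:: (1,3)];
  Red [:: 1] [:: (0,1,4); (1,3,5); (1,6,7)] [:: (1,3); (1,4); (1,5)] [:: (1,2)];
  Red [:: 0;1] [:: (0,2,3); (1,3,4); (0,1,5); (2,4,5)]
    [:: (0,1); (1,6); (1,7)] [:: (3,5)];
  Red [:: 0;1] [:: (0,2,4); (1,2,5); (0,3,5); (1,4,7)]
    [:: (0,2); (0,4); (1,5); (1,6)] [:: (1,3); (2,7)];
  Red [:: 0;1] [:: (0,1,3); (1,2,4); (0,2,5); (3,4,5)]
    [:: (0,1); (2,3); (1,7)] [:: (1,6)];
  Red [:: 1] [:: (0,1,5); (1,3,6); (1,4,7)]
    [:: (1,3); (1,4); (1,5)] [:: (1,2); (6,7)];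
  Red [:: 1] [:: (0,1,5); (1,3,6); (1,2,7)]
    [:: (1,2); (1,3); (1,5)] [:: (1,4); (6,7)];
  Red [:: 0;1] [:: (0,1,2); (0,3,4); (1,3,5); (2,4,5); (1,4,7)]
    [:: (0,1); (2,3); (1,6); (1,7)] [::];
  Red [:: 0;1] [:: (0,1,2); (0,3,5); (1,4,5); (1,3,6)]
    [:: (0,2); (1,2); (0,3); (1,4); (1,5)] [:: (3,7); (6,7)];
  Red [:: 1] [:: (0,1,3); (1,2,5); (1,4,6)]
    [:: (1,2); (1,4); (1,5)] [:: (3,6); (3,7); (6,7)];
  Red [:: 1] [:: (0,1,3); (1,2,4)]
    [:: (1,2); (1,4)] [:: (1,5); (3,6); (3,7); (6,7)];
  Red [:: 0;1] [:: (0,2,4); (1,3,4); (1,2,5); (0,3,5)]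
    [:: (1,2); (0,3); (0,4); (1,5)] [:: (3,6); (4,6); (3,7); (4,7); (6,7)];
  Red [:: 0;1] [:: (0,1,2); (1,3,4); (2,3,5); (0,4,5)]
    [:: (0,1); (1,6); (1,7)] [:: (2,4)];
  Red [:: 1] [:: (0,1,2); (1,3,6); (1,4,7)]
    [:: (1,2); (1,3); (1,4)] [:: (1,5); (6,7)];
  Red [:: 0;1] [:: (0,1,2); (2,3,4); (1,3,5); (0,4,5)]
    [:: (0,1); (2,5); (1,7)] [:: (1,6)];
  Red [:: 0;1] [:: (0,2,3); (0,1,4); (1,2,5); (3,4,5)]
    [:: (0,1); (2,4); (1,7)] [:: (1,6)];
  Red [:: 1] [:: (1,2,3); (0,1,4); (1,6,7)] [:: (1,2); (1,3); (1,4)] [:: (1,5)];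
  Red [:: 0;1] [:: (0,2,4); (1,3,4); (0,1,5); (2,3,5)]
    [:: (0,1); (4,5); (1,7)] [:: (1,6)];
  Red [:: 0;1] [:: (0,1,3); (2,3,4); (1,2,5); (0,4,5)]
    [:: (0,1); (3,5); (1,6)] [:: (1,7)];
  Red [:: 0;1] [:: (1,2,3); (0,1,4); (0,3,5); (2,4,5)]
    [:: (0,1); (3,4); (1,6)] [:: (1,7)];
  Red [:: 0;1] [:: (0,1,3); (2,3,4); (0,2,5); (1,4,5)]
    [:: (0,1); (3,5); (1,6)] [:: (1,7)];
  Red [:: 0;1] [:: (0,3,4); (0,1,5); (2,3,5); (1,4,6)]
    [:: (1,2); (0,4); (1,5)] [:: (1,3); (4,7); (6,7)];
  Red [:: 0;1] [:: (0,1,2); (0,3,5); (2,4,5); (1,3,6)]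
    [:: (1,2); (0,3); (1,5)] [:: (1,4); (3,7); (6,7)];
  Red [:: 0;1] [:: (0,1,2); (0,3,4); (2,4,5); (1,3,6)]
    [:: (1,2); (0,3); (1,4)] [:: (1,5); (3,7); (6,7)];
  Red [:: 1] [:: (0,1,3); (1,2,5)]
    [:: (1,2); (1,5)] [:: (1,4); (3,6); (3,7); (6,7)];
  Red [:: 0;1] [:: (1,2,3); (0,2,4); (0,3,5); (1,4,5)]
    [:: (0,1); (3,4); (1,6); (1,7)] [:: (2,5)];
  Red [:: 0;1] [:: (0,1,3); (1,2,4); (0,2,5); (3,4,5)]
    [:: (0,1); (1,6); (1,7)] [:: (2,3)];
  Red [:: 0;1] [:: (1,2,3); (0,1,4); (0,3,5); (2,4,5)]
    [:: (0,1); (1,6); (1,7)] [:: (3,4)]].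

Lemma exhaustive_child5 : exhaustive 8 2 (star_rows 5)
  (link (iota 1 5)) child5_table.
Proof. by lazy. Qed.

Definition child6_table : seq reduction := [::
  Red [:: 0;1] [:: (0,1,2); (0,3,4); (1,3,6); (0,5,6)]
    [:: (0,1); (0,2); (1,2); (0,4); (1,7)] [:: (1,4); (3,5)];
  Red [:: 0;1] [:: (0,2,3); (0,1,4); (1,2,5); (0,5,6)]
    [:: (0,1); (0,3); (0,4); (1,4); (1,7)] [:: (1,3); (2,6)];
  Red [:: 0;1] [:: (0,1,2); (0,3,5); (1,3,6); (0,4,6)]
    [:: (0,1); (0,4); (2,5); (2,6); (1,7)] [:: (2,3); (1,4); (5,6)];
  Red [:: 0;1] [:: (0,2,3); (1,3,4); (0,1,5); (0,4,6)]
    [:: (0,1); (0,2); (0,5); (1,5); (1,7)] [:: (1,2); (3,6)];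
  Red [:: 0;1] [:: (1,2,3); (0,2,4); (0,1,5); (0,3,6); (1,4,6)]
    [:: (0,1); (3,4); (0,5); (1,5); (2,6); (1,7)] [::];
  Red [:: 0;1] [:: (1,2,3); (0,2,4); (0,3,5); (0,1,6); (3,4,6); (2,5,6)]
    [:: (0,1); (4,5); (1,7)] [::];
  Red [:: 0;1] [:: (0,1,4); (0,2,5); (1,2,6); (0,3,6)]
    [:: (0,1); (0,3); (0,4); (1,4); (1,7)] [:: (1,3); (5,6)];
  Red [:: 0;1] [:: (1,2,3); (0,3,4); (0,2,6); (1,4,6)]
    [:: (0,1); (0,5); (1,5); (1,7)] [:: (2,4); (3,6)];
  Red [:: 0;1] [:: (1,2,3); (0,1,4); (0,2,5); (0,3,6)]
    [:: (0,1); (3,4); (4,5); (0,6); (1,7)] [:: (2,4); (3,5); (1,6)];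
  Red [:: 0;1] [:: (0,1,4); (2,3,4); (0,2,5); (1,3,5); (0,3,6)]
    [:: (0,1); (4,5); (0,6); (1,7)] [:: (1,6)];
  Red [:: 0;1] [:: (0,1,4); (2,3,4); (0,3,5); (0,2,6); (1,3,6)]
    [:: (0,1); (0,5); (1,5); (1,7)] [:: (4,6)];
  Red [:: 0;1] [:: (0,1,4); (1,2,5); (0,3,5); (0,2,6)]
    [:: (0,1); (0,4); (1,4); (0,6); (1,7)] [:: (2,3); (1,6)];
  Red [:: 0;1] [:: (1,2,3); (0,2,4); (0,3,6); (1,4,6)]
    [:: (0,1); (0,5); (1,5); (1,7)] [:: (3,4); (2,6)];
  Red [:: 0;1] [:: (0,2,4); (0,1,5); (0,3,6); (1,4,6); (2,5,6)]
    [:: (0,1); (0,3); (4,5); (1,7)] [:: (1,3)];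
  Red [:: 0;1] [:: (0,3,4); (0,1,5); (0,2,6); (1,4,6); (3,5,6)]
    [:: (0,1); (0,2); (4,5); (1,7)] [:: (1,2)];
  Red [:: 0;1] [:: (0,1,4); (0,3,5); (0,2,6); (1,3,6)]
    [:: (0,1); (0,2); (0,4); (1,4); (1,7)] [:: (1,2); (5,6)];
  Red [:: 0;1] [:: (0,2,3); (0,1,4); (1,2,6); (0,5,6)]
    [:: (0,1); (0,3); (0,4); (1,4); (1,7)] [:: (1,3); (2,5)];
  Red [:: 0;1] [:: (1,2,3); (0,1,4); (0,3,5); (0,2,6)]
    [:: (0,1); (0,4); (1,4); (0,6); (1,7)] [:: (2,5); (1,6)];
  Red [:: 0;1] [:: (0,2,3); (0,1,4); (1,3,6); (0,5,6)]
    [:: (0,1); (0,2); (0,4); (1,4); (1,7)] [:: (1,2); (3,5)];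
  Red [:: 0;1] [:: (0,1,2); (1,3,4); (0,3,5); (0,4,6); (1,5,6)]
    [:: (0,1); (0,2); (1,2); (4,5); (3,6); (1,7)] [::];
  Red [:: 0;1] [:: (0,1,3); (0,2,4); (1,2,6); (0,5,6)]
    [:: (0,1); (0,3); (1,3); (0,4); (1,7)] [:: (1,4); (2,5)];
  Red [:: 0;1] [:: (0,2,4); (1,3,4); (1,2,6); (0,3,6)]
    [:: (0,1); (0,5); (1,5); (1,7)] [:: (2,3); (4,6)]].

Lemma exhaustive_child6 : exhaustive 8 2 (star_rows 6)
  (link (iota 1 6)) child6_table.
Proof. by lazy. Qed.

(** * Tables for two or three children *)

Definition pair500_table : seq reduction := [::
  Red [:: 0;1] [:: (1,2,4); (0,3,4); (0,2,6); (1,3,6)]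
    [:: (2,3); (0,5); (1,5); (4,6)] [::];
  Red [:: 0;1] [:: (1,2,5); (0,3,5); (0,2,6); (1,3,6)]
    [:: (2,3); (0,4); (1,4); (5,6)] [::];
  Red [:: 0;1] [:: (1,2,4); (0,3,4); (0,2,5); (1,3,5)]
    [:: (2,3); (4,5); (0,6); (1,6)] [::]].

(** Here and below the three digits in the name are the parameters [c], [a] and [b] of
    [pair_rows]. *)
Lemma exhaustive_pair500 : exhaustive 7 2 (pair_rows 5 0 0)
  (link (pair_link1 5 0) ++ link (pair_link2 5 0 0)) pair500_table.
Proof. by lazy. Qed.

Definition pair411_table : seq reduction := [::
  Red [:: 0;1] [:: (0,2,4); (1,3,4); (0,3,5); (1,2,7)]
    [:: (2,3); (4,5); (0,6); (1,7)] [:: (2,5)];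
  Red [:: 0;1] [:: (0,3,4); (0,2,5); (1,3,5); (1,2,7)]
    [:: (2,3); (4,5); (0,6); (1,7)] [:: (2,4)];
  Red [:: 0;1] [:: (1,2,4); (0,2,5); (1,3,5); (0,3,6)]
    [:: (2,3); (4,5); (0,6); (1,7)] [:: (3,4)];
  Red [:: 0;1] [:: (0,2,4); (1,3,4); (1,2,5); (0,3,5)]
    [:: (2,3); (4,5); (0,6); (1,7)] [::];
  Red [:: 0;1] [:: (0,2,4); (1,3,4); (1,2,5); (0,3,6)]
    [:: (2,3); (4,5); (0,6); (1,7)] [:: (3,5)]].

Lemma exhaustive_pair411 : exhaustive 8 2 (pair_rows 4 1 1)
  (link (pair_link1 4 1) ++ link (pair_link2 4 1 1)) pair411_table.
Proof. by lazy. Qed.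

Definition pair322_table : seq reduction := [::
  Red [:: 0;1] [:: (0,2,3); (1,3,4); (2,4,5); (0,4,6); (1,2,8)]
    [:: (0,6); (1,7); (1,8)] [:: (3,5)];
  Red [:: 0;1] [:: (0,2,4); (1,3,4); (0,3,5); (2,3,7); (1,2,8)]
    [:: (0,5); (0,6); (1,8)] [:: (4,7)];
  Red [:: 0;1] [:: (0,2,4); (1,3,4); (2,3,5); (0,5,6); (1,7,8)]
    [:: (0,6); (1,7); (1,8)] [:: (4,5)];
  Red [:: 0;1] [:: (1,2,3); (0,2,4); (0,5,6); (1,7,8)]
    [:: (0,5); (0,6); (1,7); (1,8)] [:: (3,4)];
  Red [:: 0;1] [:: (1,2,4); (0,3,4); (0,5,6); (2,3,8); (1,7,8)]
    [:: (0,5); (0,6); (1,7)] [:: (4,8)];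
  Red [:: 0;1] [:: (1,2,3); (0,2,4); (0,3,5); (3,4,6); (1,4,8)]
    [:: (0,5); (1,7); (1,8)] [:: (2,6)];
  Red [:: 0;1] [:: (1,2,3); (0,3,4); (0,2,6); (1,4,7); (2,4,8); (3,7,8)]
    [:: (0,5); (0,6)] [:: (2,7)];
  Red [:: 0;1] [:: (1,2,3); (0,4,5); (0,2,6); (3,4,6); (2,4,7); (1,4,8)]
    [:: (0,5); (1,8)] [:: (3,7)];
  Red [:: 0;1] [:: (0,3,4); (0,2,6); (2,3,7); (1,4,7); (1,3,8); (2,4,8)]
    [:: (0,5); (0,6)] [:: (7,8)];
  Red [:: 0;1] [:: (1,2,3); (0,2,4); (3,4,5); (0,5,6); (1,7,8)]
    [:: (0,6); (1,7); (1,8)] [:: (2,5)];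
  Red [:: 0;1] [:: (1,2,3); (0,2,5); (3,4,5); (0,3,6); (2,4,6); (1,4,7)]
    [:: (1,7); (1,8)] [:: (5,6)];
  Red [:: 0;1] [:: (1,2,4); (0,3,4); (0,2,5); (2,3,6); (1,7,8)]
    [:: (0,5); (1,7); (1,8)] [:: (4,6)];
  Red [:: 0;1] [:: (0,2,3); (1,2,4); (0,4,5); (3,4,8); (1,7,8)]
    [:: (0,5); (0,6); (1,7)] [:: (2,8)];
  Red [:: 0;1] [:: (0,2,3); (1,3,4); (0,5,6); (1,7,8)]
    [:: (0,5); (0,6); (1,7); (1,8)] [:: (2,4)];
  Red [:: 0;1] [:: (0,2,3); (1,3,4); (0,4,5); (2,4,8); (1,7,8)]
    [:: (0,5); (0,6); (1,7)] [:: (3,8)];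
  Red [:: 0;1] [:: (0,2,3); (1,3,4); (0,4,5); (2,4,6); (1,2,8)]
    [:: (0,5); (1,7); (1,8)] [:: (3,6)];
  Red [:: 0;1] [:: (1,2,4); (0,3,4); (0,5,6); (1,3,8)]
    [:: (0,5); (0,6); (1,7); (1,8)] [:: (2,3)]].

(* The first term, stating that both links are cliques, is not refuted; this
   is the case left to [two_children] and [three_children]. *)
Lemma exhaustive_pair322 : exhaustive 9 2 (pair_rows 3 2 2)
  ((pairs_of (pair_link1 3 2) ++ pairs_of (pair_link2 3 2 2), [::]) ::
    link (pair_link1 3 2) ++ link (pair_link2 3 2 2)) pair322_table.
Proof. by lazy. Qed.

Definition pair501_table : seq reduction := [::
  Red [:: 0;1] [:: (0,2,4); (1,2,5); (1,4,6); (0,5,6); (1,3,7)]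
    [:: (0,3); (1,3); (4,5); (2,6); (1,7)] [::];
  Red [:: 0;1] [:: (0,2,3); (1,2,5); (1,4,6); (0,5,6); (1,3,7)]
    [:: (0,3); (1,3); (4,5); (2,6); (1,7)] [:: (2,4)];
  Red [:: 0;1] [:: (1,2,3); (0,2,4); (0,3,5); (1,4,5); (1,6,7)]
    [:: (3,4); (2,5); (0,6); (1,6); (1,7)] [::]].

Lemma exhaustive_pair501 : exhaustive 8 2 (pair_rows 5 0 1)
  (link (pair_link1 5 0) ++ link (pair_link2 5 0 1)) pair501_table.
Proof. by lazy. Qed.

Definition pair412_table : seq reduction := [::
  Red [:: 0;1] [:: (1,2,3); (0,3,4); (0,2,5); (1,4,5)]
    [:: (3,5); (0,6); (1,7); (1,8)] [:: (2,4)];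
  Red [:: 0;1] [:: (0,2,3); (1,3,4); (1,2,5); (0,4,5)]
    [:: (2,4); (0,6); (1,7); (1,8)] [:: (3,5)];
  Red [:: 0;1] [:: (0,2,4); (1,3,4); (1,2,5); (0,3,5)]
    [:: (4,5); (0,6); (1,7); (1,8)] [:: (2,3)];
  Red [:: 0;1] [:: (1,2,4); (0,3,4); (0,2,5); (1,3,5)]
    [:: (2,3); (0,6); (1,7); (1,8)] [:: (4,5)];
  Red [:: 0;1] [:: (0,2,3); (1,3,4); (1,2,5); (0,4,5); (2,4,7); (3,5,7)]
    [:: (0,6); (1,8)] [::];
  Red [:: 0;1] [:: (0,2,3); (1,2,4); (1,3,5); (0,4,5); (1,7,8)]
    [:: (3,4); (2,5); (0,6); (1,7); (1,8)] [::]].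

Lemma exhaustive_pair412 : exhaustive 9 2 (pair_rows 4 1 2)
  (link (pair_link1 4 1) ++ link (pair_link2 4 1 2)) pair412_table.
Proof. by lazy. Qed.

Definition pair511_table : seq reduction := [::
  Red [:: 0;1] [:: (0,2,4); (1,4,5); (1,2,6); (0,5,6); (0,3,7); (1,3,8)]
    [:: (0,3); (1,3); (2,5); (4,6); (0,7); (1,8)] [::];
  Red [:: 0;1] [:: (1,2,3); (0,2,4); (0,3,6); (1,5,6); (1,4,8)]
    [:: (0,5); (1,5); (4,6); (0,7); (1,8)] [:: (3,4); (2,6)];
  Red [:: 0;1] [:: (0,2,3); (1,3,5); (1,2,6); (0,5,6); (0,4,7); (1,4,8)]
    [:: (0,4); (1,4); (2,5); (3,6); (0,7); (1,8)] [::];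
  Red [:: 0;1] [:: (0,2,4); (1,3,4); (1,2,6); (0,3,6); (0,5,7); (1,5,8)]
    [:: (2,3); (0,5); (1,5); (4,6); (0,7); (1,8)] [::];
  Red [:: 0;1] [:: (1,2,4); (0,4,5); (0,2,6); (1,3,6); (0,3,7); (1,5,8)]
    [:: (2,3); (0,5); (1,5); (4,6); (0,7); (1,8)] [:: (3,4)];
  Red [:: 0;1] [:: (1,3,4); (0,4,5); (1,2,6); (0,3,6); (0,2,7); (1,5,8)]
    [:: (2,3); (0,5); (1,5); (4,6); (0,7); (1,8)] [:: (2,4)];
  Red [:: 0;1] [:: (1,2,4); (0,3,4); (1,3,6); (0,5,6); (0,2,7); (1,5,8)]
    [:: (2,3); (0,5); (1,5); (4,6); (0,7); (1,8)] [:: (2,6)]].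

Lemma exhaustive_pair511 : exhaustive 9 2 (pair_rows 5 1 1)
  (link (pair_link1 5 1) ++ link (pair_link2 5 1 1)) pair511_table.
Proof. by lazy. Qed.

Definition pair600_table : seq reduction := [::
  Red [:: 0;1] [:: (1,2,3); (1,4,5); (0,5,6); (0,4,7); (1,6,7)]
    [:: (0,2); (1,2); (0,3); (1,3); (5,7)] [:: (4,6)];
  Red [:: 0;1] [:: (1,2,3); (0,2,5); (1,4,5); (0,4,6); (0,3,7); (1,6,7)]
    [:: (0,4); (1,4); (0,6); (1,6); (2,7); (5,7)] [:: (3,5)];
  Red [:: 0;1] [:: (1,2,3); (0,2,4); (1,4,6); (0,5,6); (0,3,7); (1,5,7)]
    [:: (0,3); (1,3); (4,5); (2,6); (0,7); (1,7)] [:: (2,5)];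
  Red [:: 0;1] [:: (0,2,3); (1,2,5); (0,4,5); (1,3,6); (1,4,7); (0,6,7)]
    [:: (0,2); (1,2); (3,4); (0,5); (1,5); (4,6)] [:: (3,7)];
  Red [:: 0;1] [:: (1,2,3); (1,4,6); (0,5,6); (0,4,7); (1,5,7)]
    [:: (0,2); (1,2); (0,3); (1,3); (4,5)] [:: (6,7)];
  Red [:: 0;1] [:: (1,2,3); (0,2,5); (0,4,6); (1,5,6); (0,3,7); (1,4,7)]
    [:: (0,2); (1,2); (3,4); (0,5); (1,5); (6,7)] [:: (3,6)];
  Red [:: 0;1] [:: (1,2,4); (0,2,5); (0,4,6); (0,3,7); (4,5,7); (1,6,7)]
    [:: (0,2); (1,2); (0,3); (1,3)] [:: (5,6)];
  Red [:: 0;1] [:: (0,2,4); (1,2,5); (1,3,6); (0,5,6); (0,3,7); (1,4,7)]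
    [:: (3,4); (0,5); (1,5); (0,6); (1,6); (2,7)] [:: (2,3)];
  Red [:: 0;1] [:: (0,2,3); (1,2,5); (0,4,5); (1,4,6); (3,5,6); (1,3,7);
      (0,6,7)]
    [:: (2,4); (3,4); (2,6); (0,7); (1,7)] [::];
  Red [:: 0;1] [:: (0,4,5); (1,4,6); (1,5,7); (0,6,7)]
    [:: (0,2); (1,2); (0,3); (1,3)] [:: (5,6); (4,7)];
  Red [:: 0;1] [:: (1,2,3); (0,4,6); (1,5,6); (1,4,7); (0,5,7)]
    [:: (0,2); (1,2); (0,3); (1,3); (6,7)] [:: (4,5)]].

Lemma exhaustive_pair600 : exhaustive 8 2 (pair_rows 6 0 0)
  (link (pair_link1 6 0) ++ link (pair_link2 6 0 0)) pair600_table.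
Proof. by lazy. Qed.

(** Label 2, the first common neighbour of the children, will be their parent. The reduction removes
    it together with one child, so its neighbours have to be labelled as well; hence the bound 3 on
    the closed labels. *)
Definition two_cliques_table : seq reduction := [::
  Red [:: 1;2] [:: (1,2,4); (0,3,4); (0,2,6); (1,3,7); (2,3,8); (4,7,8)]
    [:: (1,2); (2,5); (2,6)] [::]].

Lemma exhaustive_two_cliques : exhaustive 9 3 (pair_rows 3 2 2)
  (present (pairs_of (pair_link1 3 2) ++ pairs_of (pair_link2 3 2 2)))
    two_cliques_table.
Proof. by lazy. Qed.

(** Labels 0, 1, 2 are the children and 3 their parent. The other common neighbours are 4, 5 for the
    children 0 and 1; 6, 7 for 0 and 2; 8, 9 for 1 and 2. Any two of the labels 3 to 9 are adjacent
    to a common child, so with complete links they span a [K_7]. *)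
Definition three_cliques_table : seq reduction := [::
  Red [:: 0;1;2] [:: (6,7,8); (4,6,9); (4,5,7); (3,8,9); (2,7,9); (2,3,6);
      (1,4,8); (1,3,5); (0,5,6); (0,3,4)]
    [:: (1,5); (3,7)] [::]].

Lemma exhaustive_three_cliques : exhaustive 10 3
  [:: nseq 3 false ++ nseq 5 true;
      nseq 3 false ++ nseq 3 true ++ nseq 2 false ++ nseq 2 true;
      nseq 3 false ++ true :: nseq 2 false ++ nseq 4 true]
  (present (pairs_of (iota 3 7))) three_cliques_table.
Proof. by lazy. Qed.

(** * Links in irreducible graphs *)

Lemma pairs_ofP q p :
  reflect [/\ p.1 \in q, p.2 \in q & p.1 < p.2] (p \in pairs_of q).
Proof.
rewrite mem_filter; apply: (iffP andP).
  by case=> lt /allpairsP[[i j] /= [iq jq def]]; move: lt; rewrite def.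
by case: p => i j /= [iq jq ->]; rewrite allpairs_f.
Qed.

Section Configurations.
Variables (T : finType) (e : rel T).
Hypotheses (sg : simple_graph e) (irr : ~ reducible e).

Lemma map_rel_const v b (s : seq T) :
  (forall x, x \in s -> e v x = b) -> [seq e v x | x <- s] = nseq (size s) b.
Proof.
elim: s => //= x s IHs ev; rewrite ev ?mem_head // IHs // => y ys.
by apply: ev; rewrite inE ys orbT.
Qed.

(** Some term of the table is satisfied; if it came from a reduction, the graph would be reducible.
    Rows are compared with [l] up to trailing [false] entries, since reading past the end of a row
    yields [false] anyway. *)
Lemma exhaustive_fact n nc rows facts rs x0 (l : seq T) :
  exhaustive n nc rows facts rs -> uniq l -> size l <= n -> nc <= size l ->
  size rows <= size l ->
  (forall i y, i < nc -> e (nth x0 l i) y -> y \in l) ->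
  (forall i, i < size rows -> exists m,
     [seq e (nth x0 l i) x | x <- l] = nth [::] rows i ++ nseq m false) ->
  exists2 t, t \in facts & sat (adj e x0 l) t.
Proof.
case/andP=> /allP val cov ul szl ncl rowl clo rowsE.
have [t] := coversP (adj e x0 l) cov.
rewrite mem_cat => /orP[tf st|/mapP[r rr ->] st]; first by exists t.
case: irr; apply: reduction_sound (val r rr) st => // i j ir jn.
have [m defrow] := rowsE i ir.
have -> : nth false (nth [::] rows i) j = nth false (nth [::] rows i ++ nseq m
  false) j.
  by rewrite nth_cat; case: ltnP => // le_j;
    rewrite nth_default // nth_nseq if_same.
rewrite -defrow /adj (leq_trans ir rowl) /=; have [jl|jl] := ltnP j (size l).
  by rewrite (nth_map x0).
by rewrite [RHS]nth_default ?size_map.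
Qed.

(** An edge in no triangle can be deleted alone: [D] consists of this edge, and [S] and [P] are
    empty. *)
Lemma edge_in_triangle x y : e x y -> exists2 z, e x z & e y z.
Proof.
move=> exy; have [z /andP[exz eyz]|noz] := pickP [pred z | e x z && e y z].
  by exists z.
case: irr.
have [sym _] := sg; have xyE : [set x; y] \in edges e by apply/edgesP; exists x, y.
exists [set [set x; y]], set0, set0; split; split=> //.
- by apply/set0Pn; exists [set x; y]; rewrite inE.
- by rewrite sub1set.
- exact: sub0set.
- by rewrite /triangle_packing sub0set; apply/forallP=> t; rewrite inE.
- by move=> t; rewrite inE.
- by rewrite cards0.
move=> t tt /pred0Pn[E /= /andP[Et]]; rewrite inE => /eqP defE; move: Et;
  rewrite {}defE => Et.
exfalso; move: Et tt; rewrite inE =>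
  /andP[_ /subsetP sub] /trianglesP[a [b [c [eab ebc eac deft]]]].
have xt : x \in t by apply: sub; rewrite !inE eqxx.
have yt : y \in t by apply: sub; rewrite !inE eqxx orbT.
have contra z : e x z -> e y z -> False by move=> exz eyz; have := noz z;
  rewrite /= exz eyz.
have [_ eirr] := sg; have nxx z : e z z -> False by rewrite eirr.
move: xt yt; rewrite deft !inE => /orP[/orP[]|] /eqP defx /orP[/orP[]|] /eqP defy;
  move: exy contra; rewrite defx defy => exy contra.
all: try by apply: nxx exy.
all: first [by apply: (contra a); rewrite // sym | by apply: (contra b);
  rewrite // sym
  | by apply: (contra c); rewrite // sym].
Qed.

End Configurations.

Lemma disjoint_pairsP q pp : pp \in disjoint_pairs q ->
  [/\ pp.1.1 \in q, pp.1.2 \in q, pp.2.1 \in q, pp.2.2 \in q &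
      uniq [:: pp.1.1; pp.1.2; pp.2.1; pp.2.2]].
Proof.
rewrite mem_filter => /andP[upp /allpairsP[[p1 p2] /= [/pairs_ofP[? ? _]
  /pairs_ofP[? ? _] def]]].
by move: upp; rewrite def.
Qed.

Section NearComplete.
Variables (T : finType) (e : rel T).
Hypotheses (sg : simple_graph e).

Definition no_path_in_complement v := forall a b c,
  all (e v) [:: a; b; c] -> uniq [:: a; b; c] -> e a b || e a c.

(** The complement of the link is a matching: it has at most one edge in degree 5, and zero, one or
    three edges in degree 6, where two disjoint non-edges force the remaining pair to be a
    non-edge. *)
Definition near_complete v :=
  [/\ #|[set y | e v y]| = 5 \/ #|[set y | e v y]| = 6,
      no_path_in_complement v,
      #|[set y | e v y]| = 5 -> forall a b c d,
        all (e v) [:: a; b; c; d] -> uniq [:: a; b; c; d] -> e a b || e c d &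
      #|[set y | e v y]| = 6 -> forall a b c d f g,
        all (e v) [:: a; b; c; d; f; g] -> uniq [:: a; b; c; d; f; g] ->
        e f g -> e a b || e c d].

Variables (x0 : T) (l : seq T).
Hypothesis ul : uniq l.

Lemma adjE i j : i < size l -> j < size l ->
  adj e x0 l i j = e (nth x0 l i) (nth x0 l j).
Proof. by rewrite /adj => -> ->. Qed.

Variables (v : T) (q : seq nat).
Hypothesis ql : forall i, i \in q -> i < size l.
Hypothesis qv : forall i, i \in q -> e v (nth x0 l i).

Let nth_q (s : seq nat) : {subset s <= q} -> uniq s ->
  all (e v) (map (nth x0 l) s) /\ uniq (map (nth x0 l) s).
Proof.
move=> sub us; split; first by apply/allP=> _ /mapP[i /sub/qv evi ->].
rewrite map_inj_in_uniq // => i j /sub/ql il /sub/ql jl /eqP.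
by rewrite nth_uniq // => /eqP.
Qed.

Lemma paths_unsat t : no_path_in_complement v -> t \in paths q ->
  ~~ sat (adj e x0 l) t.
Proof.
move=> nop /flatten_mapP[a aq /mapP[[b c] /pairs_ofP[]]].
rewrite /= !mem_filter => /andP[ba bq] /andP[ca cq] bc ->.
have sub : {subset [:: a; b; c] <= q} by move=> i; rewrite !inE => /or3P[]/eqP->.
have u3 : uniq [:: a; b; c].
  by rewrite /= !inE negb_or !(eq_sym a) ba ca /= andbT neq_ltn bc.
have [ev ul3] := nth_q sub u3.
by rewrite /sat /= !adj_label // !adjE ?ql // !andbT -negb_or negbK nop.
Qed.

Lemma link_unsat t : near_complete v -> uniq q -> size q = #|[set y | e v y]| ->
  t \in link q -> ~~ sat (adj e x0 l) t.
Proof.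
case=> dv nop two three uq szq; rewrite mem_cat => /orP[|];
  first exact: paths_unsat.
case: ifP => [/eqP sz5|sz5].
  move=> /mapP[[[a b] [c d]] /disjoint_pairsP/= [aq bq cq dq u4] ->].
  have sub : {subset [:: a; b; c; d] <= q}.
    by move=> i; rewrite !inE => /or4P[]/eqP->.
  have [ev ul4] := nth_q sub u4.
  rewrite /sat /= !adjE ?ql // !andbT -negb_or negbK two //.
  by rewrite -szq.
move=> /flatten_mapP[[[a b] [c d]] /disjoint_pairsP/= [aq bq cq dq u4]].
case/mapP=> [[f g] /pairs_ofP[]] /=;
  rewrite !mem_filter => /andP[nf fq] /andP[ng gq] fg ->.
have sub : {subset [:: a; b; c; d; f; g] <= q}.
  by move=> i; rewrite in_cons => /predU1P[->|] //;
    rewrite !inE => /orP[|/or4P[]]/eqP->.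
have u6 : uniq ([:: a; b; c; d] ++ [:: f; g]).
  rewrite cat_uniq; apply/and3P; split=> //=; last by rewrite inE neq_ltn fg.
  by rewrite orbF negb_or nf ng.
have [ev ul6] := nth_q sub u6.
have sz6 : #|[set y | e v y]| = 6.
  by case: dv => // dv5; rewrite szq dv5 eqxx in sz5.
rewrite /sat /= !adjE ?ql // !andbT -negb_or.
by apply/negP=> /andP[efg]; rewrite (three sz6 _ _ _ _ _ _ ev).
Qed.

(** The edge from [v] to the vertex labelled [j] lies in a triangle, whose third vertex is a
    neighbour of that vertex in the link. *)
Lemma isolated_unsat t : ~ reducible e ->
  (forall y, e v y -> exists2 i, i \in q & y = nth x0 l i) ->
  t \in isolated q -> ~~ sat (adj e x0 l) t.
Proof.
move=> irr surj /mapP[j jq ->].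
have [z evz ejz] := edge_in_triangle sg irr (qv jq).
have [k kq defz] := surj z evz.
rewrite /sat /= -has_predC; apply/hasP; exists (label_pair j k).
  apply/mapP; exists k => //; rewrite mem_filter kq andbT.
  by apply: contraTneq ejz => kj; have [_ eirr] := sg; rewrite defz kj eirr.
by rewrite /= negbK adj_label // adjE ?ql // -defz.
Qed.

End NearComplete.

Section Star.
Variables (T : finType) (e : rel T).
Hypotheses (sg : simple_graph e) (irr : ~ reducible e).
Variables (v : T).

(** Allows prescribed vertices to receive the first labels. *)
Lemma extend_uniq (s : seq T) (A : {set T}) : uniq s -> {subset s <= A} ->
  exists s', [/\ uniq (s ++ s'), s ++ s' =i A & size (s ++ s') = #|A|].
Proof.
move=> us sA; exists (enum (A :\: [set x in s])).
have mem_s : s ++ enum (A :\: [set x in s]) =i A.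
  move=> x; rewrite mem_cat mem_enum !inE.
  by have [/sA->|] := boolP (x \in s).
have u : uniq (s ++ enum (A :\: [set x in s])).
  rewrite cat_uniq us enum_uniq andbT; apply/hasPn=> x.
  by rewrite mem_enum !inE => /andP[].
by split=> //; rewrite -(card_uniqP u); apply: eq_card.
Qed.

Lemma star_fact d facts rs (s : seq T) :
  uniq s -> s =i [set y | e v y] -> size s = d ->
  exhaustive d.+1 1 (star_rows d) facts rs ->
  exists2 t, t \in facts & sat (adj e v (v :: s)) t.
Proof.
move=> us sN szs chk; have [_ eirr] := sg.
have vs : v \notin s by rewrite sN inE eirr.
apply: (exhaustive_fact sg irr chk) => //=.
- by rewrite vs.
- by rewrite szs.
- by move=> [|//] y _ /= evy; rewrite inE sN inE evy orbT.
move=> [|//] _; exists 0; rewrite cats0 /= eirr -szs (@map_rel_const _ e v true) //.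
by move=> x; rewrite sN inE.
Qed.

Lemma star_isolated d (s : seq T) t :
  uniq s -> s =i [set y | e v y] -> size s = d -> t \in isolated (iota 1 d) ->
  ~~ sat (adj e v (v :: s)) t.
Proof.
move=> us sN szs tf.
apply: (isolated_unsat sg (v := v) (q := iota 1 d)) => //.
- by move=> i; rewrite /= mem_iota szs add1n => /andP[].
- move=> [|i]; rewrite mem_iota //= add1n ltnS => id.
  by have : nth v s i \in s by [rewrite mem_nth ?szs]; rewrite sN inE.
move=> y evy; have ys : y \in s by rewrite sN inE.
exists (index y s).+1; first by rewrite mem_iota add1n !ltnS -szs /= index_mem.
by rewrite /= nth_index.
Qed.

Lemma star_paths d (s : seq T) t : no_path_in_complement e v ->
  uniq s -> s =i [set y | e v y] -> size s = d -> t \in paths (iota 1 d) ->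
  ~~ sat (adj e v (v :: s)) t.
Proof.
move=> nop us sN szs tf; have [_ eirr] := sg.
have vs : v \notin s by rewrite sN inE eirr.
have ul : uniq (v :: s) by rewrite /= vs.
apply: (paths_unsat sg ul (v := v) (q := iota 1 d)) => //.
- by move=> i; rewrite /= mem_iota szs add1n => /andP[].
- move=> [|i]; rewrite mem_iota //= add1n ltnS => id.
  by have : nth v s i \in s by [rewrite mem_nth ?szs]; rewrite sN inE.
Qed.

(** For degrees 1 to 4 the only alternative left by the tables is an isolated vertex of the link,
    which irreducibility excludes. *)
Lemma degree_ge5 x : e v x -> 4 < #|[set y | e v y]|.
Proof.
move=> evx; set N := [set y | e v y].
have [s [us sN szs]] := @extend_uniq [::] N isT (fun _ => ltac:(by [])).
rewrite ltnNge; apply/negP=> le4.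
have contra rs (chk : exhaustive (size s).+1 1 (star_rows (size s))
    (isolated (iota 1 (size s))) rs) : False.
  have [t tf] := star_fact us sN erefl chk.
  exact/negP/(star_isolated us sN erefl tf).
have s0 : 0 < size s by rewrite szs (cardD1 x) inE evx.
move: s0 contra; rewrite szs; case: #|N| le4 => [|[|[|[|[|//]]]]] // _ _.
- by move/(_ _ exhaustive_star1).
- by move/(_ _ exhaustive_star2).
- by move/(_ _ exhaustive_star3).
by move/(_ _ exhaustive_star4).
Qed.

(** The vertices of the forbidden configuration get the labels from 1 on. Paths in the complement
    come first, because the tables for matchings take their absence as a fact. *)
Lemma irreducible_near_complete x : e v x -> #|[set y | e v y]| <= 6 ->
  near_complete e v.
Proof.
move=> evx le6; have ge5 := degree_ge5 evx; set N := [set y | e v y] in le6 ge5.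
have dN : #|N| = 5 \/ #|N| = 6.
  by move: le6; rewrite leq_eqVlt ltnS => /predU1P[->|le5]; [right|left;
    apply/eqP; rewrite eqn_leq le5].
have adjs s i j : i < size s -> j < size s ->
    adj e v (v :: s) i.+1 j.+1 = e (nth v s i) (nth v s j).
  by rewrite /adj /= !ltnS => -> ->.
have nop : no_path_in_complement e v.
  move=> a b c ev u3; apply/negPn/negP; rewrite negb_or => /andP[nab nac].
  have sub : {subset [:: a; b; c] <= N} by move=> y /(allP ev); rewrite inE.
  have [s [us sN szs]] := extend_uniq u3 sub.
  have contra rs (chk : exhaustive (size ([:: a; b; c] ++ s)).+1 1
      (star_rows (size ([:: a; b; c] ++ s)))
      (absent [:: (1, 2); (1, 3)] ++ isolated (iota 1 (size ([:: a; b;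
        c] ++ s)))) rs) : False.
    have [t] := star_fact us sN erefl chk; rewrite mem_cat => /orP[|tf]; last first.
      exact/negP/(star_isolated us sN erefl tf).
    by rewrite !inE => /orP[]/eqP->;
      rewrite /sat /= adjs //= ?(negPf nab) ?(negPf nac).
  move: contra; rewrite szs; case: dN => ->;
    first by move/(_ _ exhaustive_star5_path).
  by move/(_ _ exhaustive_star6_path).
split=> //.
- move=> d5 a b c d ev u4; apply/negPn/negP; rewrite negb_or => /andP[nab ncd].
  have sub : {subset [:: a; b; c; d] <= N} by move=> y /(allP ev); rewrite inE.
  have [s [us sN szs]] := extend_uniq u4 sub; rewrite -/N d5 in szs.
  have [t] := star_fact us sN szs exhaustive_star5_matching.
  rewrite mem_cat => /orP[|tf]; last exact/negP/(star_paths nop us sN szs tf).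
  by rewrite !inE => /orP[]/eqP->;
    rewrite /sat /= adjs //= ?(negPf nab) ?(negPf ncd).
move=> d6 a b c d f g ev u6 efg; apply/negPn/negP;
  rewrite negb_or => /andP[nab ncd].
have sub : {subset [:: a; b; c; d; f; g] <= N} by move=> y /(allP ev); rewrite inE.
have [s [us sN szs]] := extend_uniq u6 sub; rewrite -/N d6 in szs.
have [t] := star_fact us sN szs exhaustive_star6_matching.
rewrite 2!mem_cat => /or3P[||tf]; last exact/negP/(star_paths nop us sN szs tf).
  by rewrite !inE => /orP[]/eqP->;
    rewrite /sat /= adjs //= ?(negPf nab) ?(negPf ncd).
by rewrite !inE => /eqP->; rewrite /sat /= adjs //= efg.
Qed.

End Star.

(** * Children of a vertex *)

Section Children.
Variables (T : finType) (e : rel T).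
Hypotheses (sg : simple_graph e) (irr : ~ reducible e).

(** Label [v], then [u], then the other neighbours of [v], then the rest of [A]. These at most 8
    vertices include all neighbours of [v] and of [u], and the tables remove both or [u] alone. *)
Lemma one_child v u (A : {set T}) : near_complete e v -> e v u ->
  u \notin A -> v \notin A -> #|A| <= 6 ->
  [set y | e v y] \subset u |: A -> [set y | e u y] \subset v |: A -> False.
Proof.
move=> ncv evu uA vA A6 /subsetP Nv /subsetP Nu; have [sym eirr] := sg.
have [s [us sN szs]] : exists s, [/\ uniq (u :: s), u :: s =i [set y | e v y]
    & size (u :: s) = #|[set y | e v y]|].
  by apply: (@extend_uniq T [:: u]) => // y; rewrite !inE => /eqP->.
set d := #|[set y | e v y]| in szs.
pose s2 := enum (A :\: [set y | e v y]).
have vs : v \notin u :: s by rewrite sN inE eirr.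
pose l := v :: (u :: s) ++ s2.
have ul : uniq l.
  rewrite cons_uniq mem_cat (negPf vs) cat_uniq us enum_uniq mem_enum !inE
    (negPf vA) andbF andbT.
  by apply/hasPn=> y; rewrite mem_enum sN inE => /andP[].
have row : [seq e v x | x <- l] = (false :: nseq d true) ++ nseq (size s2) false.
  rewrite map_cons eirr map_cat (@map_rel_const _ e v true) ?szs => [|y].
    by rewrite (@map_rel_const _ e v false) // => y;
      rewrite mem_enum !inE => /andP[/negPf].
  by rewrite sN inE.
(* All neighbours of [v] except [u] lie in [A], so the vertices of [A] outside the link number at
   most [#|A|.+1 - d]. *)
have sz2 : size s2 + d <= 7.
  have dle : d <= #|A :&: [set y | e v y]|.+1.
    rewrite -add1n -(cards1 u); apply: leq_trans (leq_card_setU _ _).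
    apply: subset_leq_card; apply/subsetP=> y yN; have := Nv y yN.
    by rewrite !in_setU in_setI yN andbT.
  rewrite -cardE; apply: leq_trans (leq_add (leqnn _) dle) _.
  by rewrite addnS ltnS addnC cardsID.
have contra rs (chk : exhaustive 8 2 (star_rows d) (link (iota 1 d)) rs) : False.
  have [|||i y|i|t tf] := exhaustive_fact sg irr chk (x0 := v) ul => //.
  - by rewrite -[size l]/((size ((u :: s) ++ s2)).+1) ltnS size_cat szs addnC.
  - rewrite /l inE mem_cat sN mem_enum !inE; case: i => [|[|//]] _ /=.
      by move=> ->; rewrite orbT.
    move=> euy; have := Nu y; rewrite !inE euy => /(_ isT)/orP[->|->] //.
    by case: (e v y); rewrite ?orbT.
  - by case: i => [|//] _; exists (size s2).
  apply/negP; apply: (link_unsat sg ul (v := v)) tf => //;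
    rewrite ?iota_uniq ?size_iota //.
    by move=> i; rewrite mem_iota add1n ltnS => /andP[_ id];
      rewrite -[size l]/((size ((u :: s) ++ s2)).+1) ltnS size_cat szs
        (leq_trans id) ?leq_addr.
  move=> [|i]; rewrite mem_iota //= add1n ltnS => id.
  have : nth v (u :: s) i \in [set y | e v y] by rewrite -sN mem_nth ?szs.
  rewrite inE => evi; suff: e v (nth v ((u :: s) ++ s2) i) by [].
  by rewrite nth_cat szs id.
by have [[d5|d6] _ _ _] := ncv; move: contra; rewrite /d ?d5 ?d6;
  [move/(_ _ exhaustive_child5)|move/(_ _ exhaustive_child6)].
Qed.

End Children.

(** * Two nonadjacent vertices and their common neighbours *)

Section Pair.
Variables (T : finType) (e : rel T).
Hypotheses (sg : simple_graph e) (irr : ~ reducible e).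
Variables (v1 v2 : T).
Hypotheses (v12 : v1 != v2) (e12 : ~~ e v1 v2).
Let N1 := [set y | e v1 y].
Let N2 := [set y | e v2 y].
Variables (s : seq T).
Hypotheses (us : uniq s) (sC : s =i N1 :&: N2).
Let sA := enum (N1 :\: N2).
Let sB := enum (N2 :\: N1).
Let l := v1 :: v2 :: s ++ sA ++ sB.
Variables (c a b : nat).
Hypotheses (szs : size s = c) (szA : size sA = a) (szB : size sB = b).

Let mem_rest y : (y \in s ++ sA ++ sB) = e v1 y || e v2 y.
Proof. by rewrite !mem_cat sC !mem_enum !inE; case: (e v1 y); case: (e v2 y). Qed.

Let ul : uniq l.
Proof.
have [sym eirr] := sg.
have hA : ~~ has (mem s) (sA ++ sB).
  by apply/hasPn=> y; rewrite mem_cat !mem_enum /= sC !inE; case: (e v1 y);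
    case: (e v2 y).
have hB : ~~ has (mem sA) sB.
  by apply/hasPn=> y; rewrite /= !mem_enum !inE; case: (e v1 y); case: (e v2 y).
rewrite 2!cons_uniq inE !mem_rest (negPf v12) !eirr (sym v2) (negPf e12) /=.
by rewrite !cat_uniq us hA hB !enum_uniq.
Qed.

Let size_l : size l = (c + a + b).+2.
Proof. by rewrite /= !size_cat szs szA szB addnA. Qed.

(** The order of the common neighbours in [s] is free, so that [two_children] can put the parent
    first. The closure condition on labels from 2 on serves the table that removes the parent
    too. *)
Lemma pair_fact nc facts rs :
  exhaustive (c + a + b).+2 nc (pair_rows c a b) facts rs ->
  nc <= (c + a + b).+2 ->
  (forall i y, 2 <= i < nc -> e (nth v1 l i) y -> y \in l) ->
  exists2 t, t \in facts & sat (adj e v1 l) t.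
Proof.
move=> chk ncl clo; have [sym eirr] := sg.
apply: (exhaustive_fact sg irr chk ul).
- by rewrite size_l.
- by rewrite size_l.
- by rewrite size_l.
- move=> [|[|i]] y inc; last by apply: clo; rewrite inc.
    by move=> /= evy; rewrite !inE mem_rest evy !orbT.
  by move=> /= evy; rewrite !inE mem_rest evy !orbT.
have consts v f : (forall y, y \in s -> e v y = true) -> (forall y, y \in sA ->
  e v y = f) ->
    (forall y, y \in sB -> e v y = ~~ f) ->
    [seq e v x | x <- s ++ sA ++ sB] = nseq c true ++ nseq a f ++ nseq b (~~ f).
  by move=> /map_rel_const h1 /map_rel_const h2 /map_rel_const h3;
    rewrite !map_cat h1 h2 h3 szs szA szB.
move=> [|[|//]] _.
  (* The first row of [pair_rows] omits its last [b] entries, the private neighbours of [v2], which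
     are all [false]. *)
  exists b; rewrite 2!map_cons /= eirr (negPf e12) (consts v1 true) //.
  - by rewrite nseqD -catA.
  - by move=> y; rewrite sC !inE => /andP[].
  - by move=> y; rewrite mem_enum !inE => /andP[].
  by move=> y; rewrite mem_enum !inE => /andP[/negPf].
exists 0; rewrite 2!map_cons /= eirr sym (negPf e12) (consts v2 false) ?cats0 //.
- by move=> y; rewrite sC !inE => /andP[].
- by move=> y; rewrite mem_enum !inE => /andP[/negPf].
by move=> y; rewrite mem_enum !inE => /andP[].
Qed.

Let q1 := pair_link1 c a.
Let q2 := pair_link2 c a b.

Let nth_s i : i \in iota 2 c -> nth v1 l i \in N1 :&: N2.
Proof.
case: i => [|[|i]]; rewrite mem_iota //= !ltnS => ic.
by rewrite nth_cat szs ic -sC mem_nth ?szs.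
Qed.

Let nth_A i : i \in iota (2 + c) a -> nth v1 l i \in N1 :\: N2.
Proof.
case: i => [|[|i]]; rewrite mem_iota //= !ltnS => /andP[ci ica].
rewrite nth_cat szs ltnNge ci /= nth_cat szA ltn_subLR // ica.
by rewrite -mem_enum mem_nth // szA ltn_subLR.
Qed.

Let nth_B i : i \in iota (2 + c + a) b -> nth v1 l i \in N2 :\: N1.
Proof.
case: i => [|[|i]]; rewrite mem_iota //= !ltnS => /andP[cai icab].
have ci : c <= i := leq_trans (leq_addr _ _) cai.
rewrite nth_cat szs ltnNge ci /= nth_cat szA ltn_subLR // ltnNge cai /=.
by rewrite -mem_enum mem_nth // szB -subnDA ltn_subLR.
Qed.

Lemma nth_q1 i : i \in q1 -> (i < size l) && e v1 (nth v1 l i).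
Proof.
rewrite size_l mem_cat => /orP[] iq; apply/andP; split.
- by move: iq; rewrite mem_iota => /andP[_ /leq_trans]; apply;
    rewrite !addSn add0n !ltnS -addnA leq_addr.
- by have := nth_s iq; rewrite !inE => /andP[].
- by move: iq; rewrite mem_iota => /andP[_ /leq_trans]; apply;
    rewrite !addSn add0n !ltnS leq_addr.
by have := nth_A iq; rewrite !inE => /andP[].
Qed.

Lemma nth_q2 i : i \in q2 -> (i < size l) && e v2 (nth v1 l i).
Proof.
rewrite size_l mem_cat => /orP[] iq; apply/andP; split.
- by move: iq; rewrite mem_iota => /andP[_ /leq_trans]; apply;
    rewrite !addSn add0n !ltnS -addnA leq_addr.
- by have := nth_s iq; rewrite !inE => /andP[].
- by move: iq; rewrite mem_iota => /andP[_ /leq_trans]; apply; rewrite !addSn add0n.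
by have := nth_B iq; rewrite !inE => /andP[].
Qed.

Let cardN1 : size q1 = #|N1|.
Proof. by rewrite size_cat !size_iota -(cardsID N2 N1) -(eq_card sC)
  (card_uniqP us) cardE szs szA. Qed.

Let cardN2 : size q2 = #|N2|.
Proof. by rewrite size_cat !size_iota -(cardsID N1 N2) setIC -(eq_card sC)
  (card_uniqP us) cardE szs szB. Qed.

Lemma pair_link t : near_complete e v1 -> near_complete e v2 ->
  t \in link q1 ++ link q2 -> ~~ sat (adj e v1 l) t.
Proof.
move=> nc1 nc2; rewrite mem_cat => /orP[] tq.
  apply: (link_unsat sg ul (v := v1)) tq =>
    // [i /nth_q1/andP[]|i /nth_q1/andP[]|] //.
  rewrite cat_uniq !iota_uniq andbT; apply/hasPn=> i;
    rewrite /= !mem_iota => /andP[ci _].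
  by rewrite (ltnNge i) ci andbF.
apply: (link_unsat sg ul (v := v2)) tq =>
  // [i /nth_q2/andP[]|i /nth_q2/andP[]|] //.
rewrite cat_uniq !iota_uniq andbT; apply/hasPn=> i;
  rewrite /= !mem_iota => /andP[ci _].
by rewrite (ltnNge i) (leq_trans (leq_addr _ _) ci) andbF.
Qed.

Let map_s : [seq nth v1 l i | i <- iota 2 c] = s.
Proof.
rewrite map_nth_iota; last by rewrite size_l !subSS subn0 -addnA leq_addr.
by rewrite /= drop0 take_size_cat.
Qed.

Let map_A : [seq nth v1 l i | i <- iota (2 + c) a] = sA.
Proof.
rewrite map_nth_iota; last by rewrite size_l !subSS -addnA addKn leq_addr.
by rewrite add2n /= drop_size_cat // take_size_cat.
Qed.

Let map_B : [seq nth v1 l i | i <- iota (2 + c + a) b] = sB.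
Proof.
rewrite map_nth_iota; last by rewrite size_l !addSn add0n !subSS addKn.
by rewrite add2n addSn addSn /= catA drop_size_cat ?size_cat ?szs ?szA //
  take_oversize ?szB.
Qed.

Lemma q1_surj x : e v1 x -> exists2 i, i \in q1 & x = nth v1 l i.
Proof.
move=> ex; suff /mapP[i iq ->] : x \in [seq nth v1 l i | i <- q1] by exists i.
by rewrite map_cat map_s map_A mem_cat sC mem_enum !inE ex; case: (e v2 x).
Qed.

Lemma q2_surj x : e v2 x -> exists2 i, i \in q2 & x = nth v1 l i.
Proof.
move=> ex; suff /mapP[i iq ->] : x \in [seq nth v1 l i | i <- q2] by exists i.
by rewrite map_cat map_s map_B mem_cat sC mem_enum !inE ex; case: (e v1 x).
Qed.

Lemma pair_complete : all (fun p =>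
  adj e v1 l p.1 p.2) (pairs_of q1 ++ pairs_of q2) ->
  (forall x y, x != y -> e v1 x -> e v1 y -> e x y) /\
  (forall x y, x != y -> e v2 x -> e v2 y -> e x y).
Proof.
move/allP=> adjs.
have main q x y : {subset pairs_of q <= pairs_of q1 ++ pairs_of q2} -> x != y ->
   (exists2 i, i \in q & x = nth v1 l i) ->
     (exists2 i, i \in q & y = nth v1 l i) -> e x y.
  move=> sub ne [i iq defx] [j jq defy]; rewrite defx defy.
  have hp p : p.1 \in q -> p.2 \in q -> p.1 < p.2 ->
    e (nth v1 l p.1) (nth v1 l p.2).
    move=> p1 p2 lt; have /adjs/and3P[] // : p \in pairs_of q1 ++ pairs_of q2.
    by apply: sub; apply/pairs_ofP.
  case: (ltngtP i j) => [lt|lt|ij]; first exact: (hp (i, j)).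
    by have [-> _] := sg; apply: (hp (j, i)).
  by rewrite defx defy ij eqxx in ne.
split=> x y ne ex ey.
  by apply: (main q1) => //; try exact: q1_surj; move=> p pq; rewrite mem_cat pq.
by apply: (main q2) => //; try exact: q2_surj; move=> p pq; rewrite mem_cat pq orbT.
Qed.

Lemma pair_present t :
  (forall x y, x != y -> e v1 x -> e v1 y -> e x y) ->
  (forall x y, x != y -> e v2 x -> e v2 y -> e x y) ->
  t \in present (pairs_of q1 ++ pairs_of q2) -> ~~ sat (adj e v1 l) t.
Proof.
move=> cl1 cl2 /mapP[p pq ->]; rewrite /sat /= andbT negbK.
move: pq; rewrite mem_cat => /orP[] /pairs_ofP[].
  move=> /nth_q1/andP[l1 e1] /nth_q1/andP[l2 e2] lt.
  by rewrite adjE // cl1 // nth_uniq // neq_ltn lt.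
move=> /nth_q2/andP[l1 e1] /nth_q2/andP[l2 e2] lt.
by rewrite adjE // cl2 // nth_uniq // neq_ltn lt.
Qed.

Lemma pair_contra rs : near_complete e v1 -> near_complete e v2 ->
  exhaustive (c + a + b).+2 2 (pair_rows c a b)
    (link q1 ++ link q2) rs -> False.
Proof.
move=> nc1 nc2 chk; have [|[|[|i]] y //|t tf] := pair_fact chk; first by [].
by apply/negP; apply: pair_link.
Qed.

End Pair.

(** With [u] the size of the union, inclusion-exclusion gives at least 3 common neighbours, and
    finitely many cases remain. The pattern with 3 of them is set apart because its table leaves an
    exception. *)
Lemma pair_sizes c a b n1 n2 u : c + a = n1 -> c + b = n2 -> u + c = n1 + n2 ->
  u <= 7 -> n1 <= n2 -> n1 = 5 \/ n1 = 6 -> n2 = 5 \/ n2 = 6 ->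
  [\/ [/\ c = 3, a = 2 & b = 2] |
   (c, a, b) \in [:: (5, 0, 0); (4, 1, 1); (5, 0, 1); (4, 1, 2); (5, 1, 1);
     (6, 0, 0)]].
Proof.
move=> <- <- /(canRL (addnK c)) -> le7 le12 d1 d2.
have le_c : c <= 6 by apply: leq_trans (leq_addr a c) _; case: d1 => ->.
have def_a : a = 5 - c \/ a = 6 - c.
  by case: d1 => /(canRL (addKn c)); [left | right].
have def_b : b = 5 - c \/ b = 6 - c.
  by case: d2 => /(canRL (addKn c)); [left | right].
move: le7 le12 {d1 d2}; case: def_a def_b => -> [] ->.
all: by case: c le_c => [|[|[|[|[|[|[|//]]]]]]] _ //; try (by right); left.
Qed.

Section Pairs.
Variables (T : finType) (e : rel T).
Hypotheses (sg : simple_graph e) (irr : ~ reducible e).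

Definition clique_link v := #|[set y | e v y]| = 5 /\
  forall x y, x != y -> e v x -> e v y -> e x y.

(** The tables exclude six of the seven size patterns. For 3 common and 2 + 2 private neighbours,
    the only fact not refuted by near-completeness says that both links are complete. *)
Lemma pair_structure_le v1 v2 :
  near_complete e v1 -> near_complete e v2 -> v1 != v2 -> ~~ e v1 v2 ->
  #|[set y | e v1 y] :|: [set y | e v2 y]| <= 7 ->
  #|[set y | e v1 y]| <= #|[set y | e v2 y]| ->
  [/\ clique_link v1, clique_link v2 & #|[set y | e v1 y] :&: [set y | e v2 y]|
    = 3].
Proof.
move=> nc1 nc2 v12 e12; set N1 := [set y | e v1 y];
  set N2 := [set y | e v2 y] => le7 le12.
have d1 : #|N1| = 5 \/ #|N1| = 6 by case: nc1.
have d2 : #|N2| = 5 \/ #|N2| = 6 by case: nc2.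
have us := enum_uniq (N1 :&: N2); have sC := mem_enum (N1 :&: N2).
have szs := cardE (N1 :&: N2); have szA := cardE (N1 :\: N2);
  have szB := cardE (N2 :\: N1).
have contra c a b rs : #|N1 :&: N2| = c -> #|N1 :\: N2| = a -> #|N2 :\: N1| = b ->
  exhaustive (c + a + b).+2 2 (pair_rows c a b)
    (link (pair_link1 c a) ++ link (pair_link2 c a b)) rs -> False.
  by move=> hc ha hb; apply: (pair_contra sg irr v12 e12 us sC) => //;
    rewrite -cardE.
have cU := cardsUI N1 N2.
have c1 := cardsID N2 N1; have c2 := cardsID N1 N2; rewrite [N2 :&: N1]setIC in c2.
have := pair_sizes c1 c2 cU le7 le12 d1 d2.
case=> [[hc ha hb]|].
  rewrite cardE in hc; rewrite cardE in ha; rewrite cardE in hb.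
  have [|[|[|i]] y //|t] := pair_fact sg irr v12 e12 us sC hc ha hb
    exhaustive_pair322; first by [].
  rewrite in_cons => /predU1P[->|tf st]; last first.
    suff: ~~ sat (adj e v1 (v1 :: v2 :: enum (N1 :&: N2) ++ enum (N1 :\: N2) ++
      enum (N2 :\: N1))) t.
      by rewrite st.
    exact: (pair_link sg v12 e12 us sC hc ha hb nc1 nc2 tf).
  rewrite /sat andbT => /(pair_complete sg sC hc ha hb)[comp1 comp2].
  rewrite -cardE in hc; rewrite -cardE in ha; rewrite -cardE in hb.
  by split=> //; split=> //; [move: c1|move: c2]; rewrite hc ?ha ?hb.
rewrite !inE !xpair_eqE => cases; exfalso; move: cases contra.
case/or4P=> [||| /or3P[]] /andP[/andP[/eqP-> /eqP->] /eqP->].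
- by move/(_ _ _ _ _ erefl erefl erefl exhaustive_pair500).
- by move/(_ _ _ _ _ erefl erefl erefl exhaustive_pair411).
- by move/(_ _ _ _ _ erefl erefl erefl exhaustive_pair501).
- by move/(_ _ _ _ _ erefl erefl erefl exhaustive_pair412).
- by move/(_ _ _ _ _ erefl erefl erefl exhaustive_pair511).
by move/(_ _ _ _ _ erefl erefl erefl exhaustive_pair600).
Qed.

Lemma pair_structure v1 v2 :
  near_complete e v1 -> near_complete e v2 -> v1 != v2 -> ~~ e v1 v2 ->
  #|[set y | e v1 y] :|: [set y | e v2 y]| <= 7 ->
  [/\ clique_link v1, clique_link v2 & #|[set y | e v1 y] :&: [set y | e v2 y]|
    = 3].
Proof.
move=> nc1 nc2 v12 e12 le7; have [sym _] := sg.
case/orP: (leq_total #|[set y | e v1 y]| #|[set y | e v2 y]|) => le12.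
  exact: pair_structure_le.
rewrite eq_sym in v12; rewrite sym in e12; rewrite setUC in le7.
by have [? ?] := pair_structure_le nc2 nc1 v12 e12 le7 le12; rewrite setIC.
Qed.

Lemma two_children v1 v2 u (A : {set T}) :
  clique_link v1 -> clique_link v2 ->
    #|[set y | e v1 y] :&: [set y | e v2 y]| = 3 ->
  v1 != v2 -> ~~ e v1 v2 -> e v1 u -> e v2 u -> #|A| <= 6 ->
  [set y | e v1 y] \subset u |: A -> [set y | e v2 y] \subset u |: A ->
  [set y | e u y] \subset [set v1; v2] :|: A -> False.
Proof.
set N1 := [set y | e v1 y]; set N2 := [set y | e v2 y].
move=> [d1 cl1] [d2 cl2] hc v12 e12 e1u e2u A6 N1A N2A /subsetP Nu.
rewrite -/N1 in d1; rewrite -/N2 in d2.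
have [s [us sC szs]] : exists s, [/\ uniq (u :: s), u :: s =i N1 :&: N2
    & size (u :: s) = #|N1 :&: N2|].
  by apply: (@extend_uniq T [:: u]) => // y; rewrite !inE => /eqP->; rewrite e1u.
rewrite hc in szs.
have ha : size (enum (N1 :\: N2)) = 2.
  by rewrite -cardE; apply: (@addnI 3); rewrite -{1}hc cardsID.
have hb : size (enum (N2 :\: N1)) = 2.
  by rewrite -cardE; apply: (@addnI 3); rewrite -{1}hc setIC cardsID.
(* The union of the links has 5 + 5 - 3 = 7 elements, hence is all of [u |: A]; so all neighbours of
   [u] are labelled. *)
have AN : A \subset N1 :|: N2.
  apply: subset_trans (subsetUr [set u] A) _.
  have /eqP-> : N1 :|: N2 == u |: A; last exact: subxx.
  rewrite eqEcard subUset N1A N2A /= [leqRHS]cardsU d1 d2 hc.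
  by apply: leq_trans (leq_card_setU _ _) _; rewrite cards1 add1n ltnS.
have [|[|[|[|i]]] y //|t] := pair_fact sg irr v12 e12 us sC szs ha hb
  exhaustive_two_cliques; first by [].
  move=> _ euy; have: y \in [set v1; v2] :|: A by apply: Nu; rewrite inE.
  rewrite in_setU in_set2 2!in_cons orbA => /orP[->//|/(subsetP AN) yN].
  rewrite !mem_cat sC !mem_enum; move: yN; rewrite !inE.
  by case: (e v1 y); case: (e v2 y); rewrite ?orbT.
by move=> tf; apply/negP; apply: (pair_present sg v12 e12 us sC szs ha hb cl1
  cl2 tf).
Qed.

(** Counting shows that [W] consists of [u] and of three disjoint pairs [a], [b], [c], each common
    to exactly two of the links. This fixes all adjacencies of the labelled vertices, as the table
    requires. *)
Lemma three_children v1 v2 v3 u (W : {set T}) :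
  clique_link v1 -> clique_link v2 -> clique_link v3 ->
  #|[set y | e v1 y] :&: [set y | e v2 y]| = 3 ->
  #|[set y | e v1 y] :&: [set y | e v3 y]| = 3 ->
  #|[set y | e v2 y] :&: [set y | e v3 y]| = 3 ->
  uniq [:: v1; v2; v3] -> ~~ e v1 v2 -> ~~ e v1 v3 -> ~~ e v2 v3 ->
  e v1 u -> e v2 u -> e v3 u -> #|W| <= 7 ->
  [set y | e v1 y] \subset W -> [set y | e v2 y] \subset W ->
  [set y | e v3 y] \subset W -> False.
Proof.
set N1 := [set y | e v1 y]; set N2 := [set y | e v2 y]; set N3 := [set y | e v3 y].
move=> [d1 cl1] [d2 cl2] [d3 cl3];
  rewrite -/N1 -/N2 -/N3 in d1 d2 d3 * => c12 c13 c23.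
move=> uv e12 e13 e23 e1u e2u e3u W7 N1W N2W N3W; have [sym eirr] := sg.
have defW : N1 :|: N2 = W.
  apply/eqP; rewrite eqEcard subUset N1W N2W cardsU d1 d2 c12.
  exact: leq_trans W7 _.
(* Since [N3] lies in [W], the union of the other two links, 5 = 3 + 3 minus the size of the triple
   intersection. *)
have all3 : N1 :&: N2 :&: N3 = [set u].
  apply/esym/eqP; rewrite eqEcard cards1 sub1set !inE e1u e2u e3u /=.
  have := cardsUI (N1 :&: N3) (N2 :&: N3);
    rewrite -setIUl defW (setIidPr N3W) c13 c23 d3.
  by rewrite setIACA setIid => /eqP; rewrite (eqn_add2l 5 _ 1) => /eqP->.
have only_u y : e v1 y -> e v2 y -> e v3 y -> y = u.
  move=> e1 e2 e3; apply/set1P; rewrite -all3 !inE e1 e2; exact: e3.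
(* The intersections with the other two links cover 3 + 3 - 1 = 5 vertices, that is, the whole
   link. *)
have fill (X Y Z : {set T}) : #|X| = 5 -> #|X :&: Y| = 3 -> #|X :&: Z| = 3 ->
    X :&: Y :&: Z = [set u] -> X \subset Y :|: Z.
  move=> dX cXY cXZ tri; apply/setIidPl/eqP; rewrite eqEcard subsetIl setIUr cardsU.
  by rewrite cXY cXZ setIACA setIid setIA tri cards1 dX.
have f1 : N1 \subset N2 :|: N3 by apply: fill.
have f2 : N2 \subset N1 :|: N3.
  by apply: fill; rewrite // ?[N2 :&: N1]setIC.
have f3 : N3 \subset N1 :|: N2 by rewrite defW.
have cD (X : {set T}) : u \in X -> #|X| = 3 -> size (enum (X :\ u)) = 2.
  by move=> uX; rewrite (cardsD1 u) uX -cardE => -[].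
have sa := cD (N1 :&: N2); have sb := cD (N1 :&: N3); have sc := cD (N2 :&: N3).
rewrite !inE e1u e2u e3u in sa sb sc.
have {}sa := sa isT c12; have {}sb := sb isT c13; have {}sc := sc isT c23.
set a := enum _ in sa; set b := enum _ in sb; set c := enum _ in sc.
have [w def_w] : exists w, w = u :: a ++ b ++ c by exists (u :: a ++ b ++ c).
have mem_w y : (y \in w) = [|| e v1 y && e v2 y, e v1 y && e v3 y | e v2 y && e
  v3 y].
  rewrite def_w inE !mem_cat !mem_enum !inE; case: eqP => [->|_] /=;
    first by rewrite e1u e2u.
  by [].
have uw : uniq w.
  rewrite def_w cons_uniq !cat_uniq !enum_uniq !mem_cat !mem_enum !inE eqxx /=
    andbT.
  have dis s1 s2 : (forall y, y \in s1 -> y \in s2 -> False) -> ~~ has (mem s1) s2.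
    by move=> h; apply/hasPn=> y y2; apply/negP=> y1; apply: h y1 y2.
  apply/andP; split; last first.
    apply: dis => y; rewrite !mem_enum !inE => /and3P[/eqP yu e1 e3] /and3P[_ e2 _].
    by apply: yu; apply: only_u.
  apply: dis => y; rewrite mem_cat !mem_enum !inE => /and3P[/eqP yu e1 e2].
  by case/orP=> /and3P[_ _ e3]; apply: yu; apply: only_u.
have ul : uniq (v1 :: v2 :: v3 :: w).
  move: uv; rewrite !cons_uniq !in_cons !in_nil !orbF !andbT => /andP[v123 v23].
  rewrite !negb_or !mem_w !eirr ![e v2 v1]sym ![e v3 v1]sym ![e v3 v2]sym.
  rewrite (negPf e12) (negPf e13) (negPf e23) /= !andbT; move: v123;
    rewrite negb_or => ->.
  by rewrite v23 uw.
have consts v fa fb fc : e v u -> (forall y, y \in a -> e v y = fa) ->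
    (forall y, y \in b -> e v y = fb) -> (forall y, y \in c -> e v y = fc) ->
    [seq e v x | x <- w] = true :: nseq 2 fa ++ nseq 2 fb ++ nseq 2 fc.
  move=> evu /map_rel_const ha /map_rel_const hb /map_rel_const hc.
  by rewrite def_w /= evu !map_cat ha hb hc sa sb sc.
have closed v y : v \in [:: v1; v2; v3] -> e v y -> y \in w.
  rewrite mem_w !inE => /or3P[]/eqP-> evy.
  - by have := subsetP f1 y; rewrite !inE evy => /(_ isT)/orP[]->; rewrite ?orbT.
  - by have := subsetP f2 y; rewrite !inE evy => /(_ isT)/orP[]->; rewrite ?orbT.
  by have := subsetP f3 y; rewrite !inE evy => /(_ isT)/orP[]->; rewrite ?orbT.
have out v v' v'' y : (forall y, e v y -> e v' y -> e v'' y -> y = u) ->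
    y != u -> e v' y -> e v'' y -> e v y = false.
  by move=> h yu e' e''; apply: contraNF yu => e0; apply/eqP; apply: h.
have sz : size (v1 :: v2 :: v3 :: w) = 10 by rewrite def_w /= !size_cat sa sb sc.
have [||||i|t] := exhaustive_fact sg irr exhaustive_three_cliques (x0 := v1) ul.
- by rewrite sz.
- by rewrite sz.
- by rewrite sz.
- move=> i y lt3 eiy; rewrite -[v1 :: _]/([:: v1; v2; v3] ++ w) mem_cat.
  apply/orP; right; apply: closed eiy.
  by case: i lt3 => [|[|[|//]]] _; rewrite !inE eqxx ?orbT.
- rewrite !map_cons; case: i => [|[|[|//]]] _ /=;
    rewrite !eirr ?[e v2 v1]sym ?[e v3 _]sym
    ?(negPf e12) ?(negPf e13) ?(negPf e23).
  + exists 2; rewrite (consts v1 true true false) // => y;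
      rewrite mem_enum !inE; try by case/and3P.
    by case/and3P=> yu e2 e3; apply: out yu e2 e3.
  + exists 0; rewrite (consts v2 true false true) // => y;
      rewrite mem_enum !inE; try by case/and3P.
    by case/and3P=> yu e1 e3; apply: out yu e1 e3 => z ? ? ?; apply: only_u.
  exists 0; rewrite (consts v3 false true true) // => y; rewrite mem_enum !inE;
    try by case/and3P.
  by case/and3P=> yu e1 e2; apply: out yu e1 e2 => z ? ? ?; apply: only_u.
case/mapP=> p /pairs_ofP[p1 p2 lt] ->; rewrite /sat /= andbT => /negP; apply.
have lab i : i \in iota 3 7 -> i < 10 /\ nth v1 (v1 :: v2 :: v3 :: w) i \in w.
  rewrite mem_iota => /andP[i3 i10]; split=> //.
  case: i i3 i10 => [|[|[|i]]] // _ i10; apply: mem_nth.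
  by move: sz => [->].
have [l1 w1] := lab _ p1; have [l2 w2] := lab _ p2.
have ne : nth v1 (v1 :: v2 :: v3 :: w) p.1 != nth v1 (v1 :: v2 :: v3 :: w) p.2.
  by rewrite nth_uniq ?sz // neq_ltn lt.
rewrite adjE ?sz //; move: w1 w2 ne; rewrite !mem_w.
move: (nth _ _ p.1) (nth _ _ p.2) => x y.
(* Each vertex lies in two of the three links, so any two vertices share a link, which is
   complete. *)
by case/or3P=> /andP[? ?] /or3P[]/andP[? ?] ne;
  first [exact: cl1 | exact: cl2 | exact: cl3].
Qed.

End Pairs.

(** * Elimination order of a tree decomposition *)

Section RootedTree.
Variables (I : finType) (r : rel I) (root : I).
Hypotheses (sym : symmetric r) (conn : forall i j, connect r i j).
Hypothesis acyclic : forall c : seq I, uniq c -> 2 < size c -> ~~ cycle r c.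

Definition avoiding i : rel I := fun a b => [&& r a b, a != i & b != i].

(** The subtree hanging from [i]: the node itself and those that it separates from the root. *)
Definition below i : {set I} := [set j | (j == i) || ~~ connect (avoiding i)
  root j].

Lemma below_refl i : i \in below i.
Proof. by rewrite inE eqxx. Qed.

Lemma not_below i j : j \notin below i = (j != i) && connect (avoiding i) root j.
Proof. by rewrite inE negb_or negbK. Qed.

Lemma avoiding_path i j p : path r j p -> i \notin j :: p -> path (avoiding i) j p.
Proof.
elim: p j => //= k p IHp j /andP[rjk pk]; rewrite !inE !negb_or => /and3P[ij ik ip].
by rewrite /avoiding rjk !(eq_sym _ i) ij ik IHp // inE negb_or ik.
Qed.

Lemma exit_below i j k : j \in below i -> k \notin below i -> r j k -> j = i.
Proof.
move=> jD; rewrite not_below => /andP[ki conk] rjk; apply/eqP;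
  apply: contraTT jD => ji.
rewrite not_below ji; apply: connect_trans conk (connect1 _).
by rewrite /avoiding sym rjk ki ji.
Qed.

(** Meant for [P] the set of nodes whose bag contains a given vertex: a walk leaving the subtree of
    [i] passes through [i] and then through a node outside. *)
Lemma exit_below_connect (P : pred I) i j k :
  connect [rel a b | [&& r a b, P a & P b]] j k -> j \in below i ->
    k \notin below i ->
  P i /\ exists2 k', P k' & r i k' && (k' \notin below i).
Proof.
case/connectP=> p; elim: p j => [|j' p IHp] j /= =>
  [_ ->|/andP[/and3P[rjj' Pj Pj'] pj'] def_k jD kD].
  by move=> ->.
have [j'D|j'D] := boolP (j' \in below i); first exact: IHp pj' def_k j'D kD.
have def_j := exit_below jD j'D rjj'; rewrite -def_j; split=> //.
by exists j' => //; rewrite rjj' def_j.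
Qed.

(** Otherwise the root reaches [j] avoiding [i], and [i] avoiding [j]. Together these walks join [i]
    to [j] without the edge between them, which closes to a cycle. *)
Lemma below_edge i j : r i j -> j \notin below i -> i \in below j.
Proof.
move=> rij jD; apply/negPn/negP=> iD; move: jD iD.
rewrite !not_below => /andP[ji cj] /andP[_ ci].
pose r' := [rel a b | r a b && ~~ ((a == i) && (b == j) || (a == j) && (b == i))].
have sub_i : subrel (avoiding i) r'.
  by move=> a b /and3P[/= -> /negPf-> /negPf->]; rewrite andbF.
have sub_j : subrel (avoiding j) r'.
  by move=> a b /and3P[/= -> /negPf-> /negPf->]; rewrite andbF.
have sym' : symmetric r'.
  by move=> a b; rewrite /= sym orbC ![(b == _) && _]andbC.
have toC e1 : subrel e1 r' -> subrel (connect e1) (connect r').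
  by move=> sub; apply: connect_sub => a b /sub; apply: connect1.
have: connect r' i j.
  apply: (@connect_trans _ _ root); last exact: toC sub_i _ _ cj.
  by rewrite (sym_connect_sym sym'); apply: toC sub_j _ _ ci.
case/connectP=> p0 pp0 last0; case/shortenP: pp0 last0 => p pp up _ def_j {p0}.
have pr : path r i p by apply: sub_path pp => a b /andP[].
(* A path with a single step would use the excluded edge. *)
have sz : 2 < size (i :: p).
  case: p pp up def_j {pr} => [_ _ ij|k [|//] /=]; first by rewrite ij eqxx in ji.
  by move=> /andP[/andP[_ nij] _] _ def_j; rewrite def_j !eqxx in nij.
by have := acyclic up sz; rewrite /= rcons_path pr -def_j sym rij.
Qed.

(** A simple path from the root to [i] meets [j] first, so [j] is not below [i]. If a path to some
    node below [i] avoided [j], it would pass through [i] and so reach [i] without [j]. *)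
Lemma below_proper i j : i \in below j -> i != j -> below i \proper below j.
Proof.
move=> iD ij.
have avoids k : ~~ connect (avoiding k) root i -> forall p, path r root p ->
    last root p = i -> k \in root :: p.
  move=> nc p pr def_i; apply: contraR nc => kp.
  by apply/connectP; exists p => //; apply: avoiding_path.
move: (iD); rewrite inE (negPf ij) => ncj.
apply/properP; split; last first.
  exists j; first exact: below_refl.
  have /connectP[p0 pp0 def_i0] := conn root i.
  case/shortenP: pp0 def_i0 => p pp up _ def_i {p0}.
  have jp := avoids j ncj p pp (esym def_i).
  rewrite not_below eq_sym ij /=; case/splitPl: jp pp up def_i => p1 p2 def_j.
  rewrite cat_path -cat_cons cat_uniq last_cat def_j =>
    /andP[pp1 _] /and3P[_ /hasPn dis _] def_i.
  apply/connectP; exists p1 => //; apply: avoiding_path pp1 _; apply: dis.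
  by case: p2 def_i => [/= ij'|k p2 /= ->];
    [rewrite ij' eqxx in ij | exact: mem_last].
apply/subsetP=> k kD; apply/negPn/negP;
  rewrite not_below => /andP[kj /connectP[p pp def_k]].
have ip : i \notin root :: p.
  by apply: contra ncj => /(path_connect pp).
move: kD; rewrite inE => /predU1P[ki|]; first by rewrite -ki def_k mem_last in ip.
move/negP; apply; apply/connectP; exists p => //; apply: avoiding_path ip.
by apply: sub_path pp => a b /and3P[].
Qed.

End RootedTree.

(** Each vertex [x] has a top node [t x], whose subtree contains all bags of [x]. Vertices are
    ordered by the size of this subtree, hence from the leaves to the root, and [up x] is the part
    of the top bag that comes later. Since [x] is in that bag but not in [up x], the bound drops
    from [k.+1] to [k]. *)
Lemma elimination_order (T : finType) (e : rel T) (k : nat) : treewidth_le e k ->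
  exists (rho : T -> nat) (up : T -> {set T}),
    [/\ injective rho,
        forall x, #|up x| <= k,
        forall x y, y \in up x -> rho x < rho y,
        forall x y, e x y -> rho x < rho y -> y \in up x
      & forall x y z, y \in up x -> z \in up x -> rho y < rho z -> z \in up y].
Proof.
case=> n [r [B [[[sym _ /card_gt0P[root _] conn acyclic] covV covE conB] widthB]]].
pose D := below r root.
have [t topP] : exists t, forall x, x \in B (t x) /\ forall i, x \in B i ->
  i \in D (t x).
  apply: (@fin_all_exists _ _ (fun x tx =>
    x \in B tx /\ forall i, x \in B i -> i \in D tx)) => x.
  have [i0 xi0] := covV x.
  (* Choose a bag of [x] with the largest subtree. If another bag of [x] were outside, the
     connection to it would leave through [i] to a neighbour with a strictly larger subtree. *)
  case: (@arg_maxnP _ i0 (fun i => x \in B i) (fun i => #|D i|) xi0) => i xi maxi.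
  exists i; split=> // j xj; apply/negPn/negP=> jD.
  have [_ [i' xi' /andP[rii' i'D]]] :=
    exit_below_connect sym (conB x i j xi xj) (below_refl r root i) jD.
  have iD := below_edge sym acyclic rii' i'D.
  have ii' : i != i' by apply: contraNneq i'D => <-; apply: below_refl.
  have := maxi i' xi'; rewrite /= leqNgt proper_card //.
  exact: below_proper.
have Bt x : x \in B (t x) by case: (topP x).
(* If [t y] is outside the subtree of [t x], the bags of [y] lead out of it through [t x]. If [t y]
   is inside, comparing sizes gives [t y = t x]. *)
have share x y i : x \in B i -> y \in B i -> #|D (t x)| <= #|D (t y)| ->
  y \in B (t x).
  move=> xi yi le; have iD : i \in D (t x) by case: (topP x) => _; apply.
  have [tyD|tyD] := boolP (t y \in D (t x)); last first.
    by have [] := exit_below_connect sym (conB y i (t y) yi (Bt y)) iD tyD.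
  have [<- //|ne] := eqVneq (t y) (t x).
  by move: le; rewrite leqNgt proper_card //; apply: below_proper.
(* The rank is below [#|T|]: it only breaks ties, and division by [#|T|] recovers the subtree
   size. *)
pose rho x := #|D (t x)| * #|T| + enum_rank x.
have T0 (x : T) : 0 < #|T| by apply/card_gt0P; exists x.
have rho_le x y : rho x < rho y -> #|D (t x)| <= #|D (t y)|.
  have div z : rho z %/ #|T| = #|D (t z)|.
    by rewrite /rho divnMDl ?(T0 z) // divn_small ?addn0.
  by move/ltnW/(leq_div2r #|T|); rewrite !div.
exists rho, (fun x => [set y in B (t x) | rho x < rho y]); split.
- move=> x y /(congr1 (modn^~ #|T|)); rewrite /rho !modnMDl !modn_small //.
  by move/val_inj/enum_rank_inj.
- move=> x; rewrite -ltnS; apply: leq_trans (widthB (t x)); apply: proper_card.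
  apply/properP; split; first by apply/subsetP=> y; rewrite inE => /andP[].
  by exists x; rewrite // inE ltnn andbF.
- by move=> x y; rewrite inE => /andP[].
- move=> x y exy lt; rewrite inE lt andbT; have [i /andP[xi yi]] := covE x y exy.
  exact: share xi yi (rho_le _ _ lt).
move=> x y z; rewrite !inE => /andP[yx _] /andP[zx _] lt; rewrite lt andbT.
exact: share yx zx (rho_le _ _ lt).
Qed.

(** * Irreducible graphs of treewidth at most 6 *)

Lemma treewidth_le_del_edges (T : finType) (e : rel T) (D : {set {set T}}) k :
  treewidth_le e k -> treewidth_le (del_edges e D) k.
Proof.
case=> n [r [B [[tree covV covE conB] width]]]; exists n, r, B; split=> //.
by split=> // x y /andP[/covE].
Qed.

Lemma treewidth6_reducible (T : finType) (e : rel T) x y :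
  simple_graph e -> treewidth_le e 6 -> e x y -> ~ ~ reducible e.
Proof.
move=> sg /elimination_order[rho [up [rho_inj up6 up_gt nbr_up up_up]]] exy irr.
have [sym eirr] := sg.
have neq_rho a b : e a b -> (rho a < rho b) || (rho b < rho a).
  by move=> eab; rewrite -neq_ltn; apply: contraTneq eab => /rho_inj->;
    rewrite eirr.
pose has_lower u := [exists v, e u v && (rho v < rho u)].
have [u0 u0low] : exists u, has_lower u.
  case/orP: (neq_rho _ _ exy) => lt; [exists y | exists x]; apply/existsP.
    by exists x; rewrite sym exy.
  by exists y; rewrite exy.
case: (@arg_minnP _ u0 has_lower rho u0low) => u ulow umin.
pose W := u |: up u.
have W7 : #|W| <= 7.
  by apply: leq_trans (leq_card_setU _ _) _; rewrite cards1 add1n ltnS.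
pose child v := e u v && (rho v < rho u).
(* A child precedes [u], so by minimality of [u] it has no earlier neighbour. *)
have child_nbr v z : child v -> e v z -> rho v < rho z.
  case/andP=> _ vu evz; case/orP: (neq_rho _ _ evz) => // zv.
  have: has_lower v by apply/existsP; exists z; rewrite evz.
  by move/umin; rewrite leqNgt vu.
(* A neighbour [z] of [v] has the earlier neighbour [v], so it is [u] or comes after [u]. Both [u]
   and [z] lie in [up v], so in the latter case [z] lies in [up u]. *)
have childN v : child v -> [set z | e v z] \subset W.
  move=> cv; apply/subsetP=> z; rewrite !inE => evz.
  have [// | zu] := eqVneq z u; have vz := child_nbr v z cv evz;
    case/andP: cv => euv vu.
  have uz : rho u < rho z.
    rewrite ltn_neqAle umin ?andbT; first by apply: contraNneq zu => /rho_inj->.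
    by apply/existsP; exists v; rewrite sym evz.
  by rewrite (up_up v) ?nbr_up // sym.
have child_nc v : child v -> near_complete e v.
  move=> cv; have /andP[euv _] := cv.
  apply: (irreducible_near_complete sg irr (x := u)); first by rewrite sym.
  apply: leq_trans (up6 v); apply: subset_leq_card; apply/subsetP=> z;
    rewrite inE => evz.
  by rewrite nbr_up // child_nbr.
have child_up v : child v -> v \notin up u.
  by case/andP=> _ vu; apply/negP=> /up_gt; rewrite ltnNge ltnW.
(* If two children were adjacent, each would have to precede the other. *)
have childs v w : child v -> child w -> ~~ e v w.
  move=> cv cw; apply/negP=> evw; have := child_nbr v w cv evw.
  by rewrite ltnNge ltnW // child_nbr // sym.
have uup : u \notin up u by apply/negP=> /up_gt; rewrite ltnn.
have Nu z : e u z -> child z || (z \in up u).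
  by move=> euz; rewrite /child euz;
    case/orP: (neq_rho _ _ euz) => [/(nbr_up _ _ euz)->|->]; rewrite ?orbT.
have child_u v : child v -> e v u by rewrite sym => /andP[].
case/existsP: ulow => v1 c1; rewrite -/(child v1) in c1.
have [v2 /andP[c2 v21]|only1] := pickP [pred v | child v & v != v1]; last first.
  apply: (one_child sg irr (child_nc _ c1) (child_u _ c1) uup (child_up _ c1)
    (up6 u) (childN _ c1)).
  apply/subsetP=> z; rewrite !inE => /Nu/orP[cz|->]; last by rewrite orbT.
  by have := only1 z; rewrite /= cz => /negbFE ->.
have structure v w : child v -> child w -> v != w ->
    [/\ clique_link e v, clique_link e w & #|[set z | e v z] :&: [set z | e w
      z]| = 3].
  move=> cv cw vw; apply: (pair_structure sg irr (child_nc v cv) (child_nc w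
    cw) vw (childs _ _ cv cw)).
  by apply: leq_trans W7; apply: subset_leq_card; rewrite subUset !childN.
rewrite eq_sym in v21; have [cl1 cl2 c12] := structure v1 v2 c1 c2 v21.
have [v3 /and3P[c3 v31 v32]|only2] :=
  pickP [pred v | [&& child v, v != v1 & v != v2]].
  rewrite eq_sym in v31; rewrite eq_sym in v32.
  have [_ cl3 c13] := structure v1 v3 c1 c3 v31.
  have [_ _ c23] := structure v2 v3 c2 c3 v32.
  apply: (three_children sg irr cl1 cl2 cl3 c12 c13 c23 _ (childs _ _ c1 c2)
    (childs _ _ c1 c3)
    (childs _ _ c2 c3) (child_u _ c1) (child_u _ c2) (child_u _ c3) W7 (childN
      _ c1) (childN _ c2)
    (childN _ c3)).
  by rewrite /= !inE negb_or v21 v31 v32.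
apply: (two_children sg irr cl1 cl2 c12 v21 (childs _ _ c1 c2) (child_u _ c1)
  (child_u _ c2)
  (up6 u) (childN _ c1) (childN _ c2)).
apply/subsetP=> z; rewrite !inE => /Nu/orP[cz|->]; last by rewrite orbT.
by have := only2 z; rewrite /= cz /= => /negbT; rewrite negb_and !negbK => ->.
Qed.

Theorem theorem3p5 (T : finType) (e : rel T) :
  simple_graph e -> treewidth_le e 6 -> tau e <= 2 * nu e.
Proof.
apply: (tuza_of_reducible (Q := fun e => treewidth_le e 6)).
  by move=> ? ?; apply: treewidth_le_del_edges.
exact: treewidth6_reducible.
Qed.
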